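(* Let $X$ and $X'$ be two real simplicial trees of valence $\ge 2$. Let $\Gamma_0$ be a torsion-free discrete subgroup of $\mathrm{Isom}(X)$ such that the quotient graph $\Gamma_0\backslash X$ is finite, and let $\rho:\Gamma_0\to\mathrm{Isom}(X')$ be a group homomorphism. (1) There exists a piecewise affine map $f:X\to X'$ which is $\rho$-equivariant, i.e. $f(\gamma\cdot x)=\rho(\gamma)\cdot f(x)$ for all $\gamma\in\Gamma_0$ and $x\in X$. Any such map is Lipschitz. (2) The infimum $C\ge 0$ of the Lipschitz constants of such maps is attained. (3) Fix a point $x_0\in X$, and let $F$ be the finite subset of $\Gamma_0\smallsetminus\{1\}$ consisting of the elements $\gamma$ such that $d(x_0,\gamma\cdot x_0)\le 4N$, where $N\ge 1$ is the number of vertices of the finite graph $\Gamma_0\backslash X$. Then $$\sup_{\gamma\in\Gamma_0\smallsetminus\{1\}}\frac{\lambda(\rho(\gamma))}{\lambda(\gamma)}=\max_{\gamma\in F}\frac{\lambda(\rho(\gamma))}{\lambda(\gamma)}=C.$$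
   Context: A real simplicial tree is a simplicial tree endowed with a distance $d$ for which the image of every injective path is isometric to a real segment; edges need not all have the same length. Valence $\ge 2$ means every vertex lies on at least two edges. $\mathrm{Isom}(X)$ is the group of bijective isometries of $X$ sending vertices to vertices and edges to edges, with the topology for which the pointwise stabilizers of compact subsets of $X$ form a basis of neighborhoods of the identity. For an isometry $g$ of a tree $X$, $\lambda(g)=\inf_{x\in X}d(x,g\cdot x)$ is its translation length; $\lambda(\gamma)>0$ for all $\gamma\in\Gamma_0\smallsetminus\{1\}$. A map $f:X\to X'$ is piecewise affine if for every edge $e$ of $X$ there is a constant $C_e\ge 0$ with $d(f(x_1),f(x_2))=C_e\,d(x_1,x_2)$ for all $x_1,x_2\in e$.
   Formalization: The bound d(x_0,γx_0) ≤ 4N defining F is replaced by 4N·l, where l is any upper bound on the edge lengths of X (l = 1 gives the printed F); as printed F can be empty, e.g. translations by 100Z on the line with vertices 100Z. *)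

(* Defs.v *)
From HB Require Import structures.
From mathcomp Require Import all_boot all_order all_algebra.
From mathcomp Require Import all_classical all_reals all_analysis.

Set Implicit Arguments.
Unset Strict Implicit.
Unset Printing Implicit Defensive.

Import Order.TTheory GRing.Theory Num.Theory.
Import numFieldNormedType.Exports.

Local Open Scope classical_set_scope.
Local Open Scope ring_scope.

Section RealSimplicialTree.
Context {R : realType}.

Definition segment_param (T : metricType R) (A : set T) (L : R) (phi : R -> T) :=
  phi @` `[0, L] = A /\
  {in `[0, L] &, forall s t, mdist (phi s) (phi t) = `|s - t|}.

Definition isometric_to_segment (T : metricType R) (A : set T) :=
  exists L : R, 0 <= L /\ exists phi : R -> T, segment_param A L phi.

Definition adjacent (T : metricType R) (V : set T) (E : set (set T)) : rel T :=
  fun u v => `[< [/\ u <> v, V u, V v & exists2 e, E e & e u /\ e v] >].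

(* A real simplicial tree is presented by its set of points with the distance
   d = mdist, its set of vertices (points) and its set of (closed) edges.
   The first five axioms describe a nonempty one-dimensional simplicial
   complex with topological segments as edges; edge_segment already uses the
   isometric parametrisation that path_segment provides for an arc. *)
Record realSimplicialTree := RealSimplicialTree {
  points :> metricType R ;
  vertices : set points ;
  edges : set (set points) ;
  vertices_neq0 : vertices !=set0 ;
  vertex_or_edge : forall x, vertices x \/ exists2 e, edges e & e x ;
  edge_segment : forall e, edges e -> exists L : R, 0 < L /\
    exists phi : R -> points,
      segment_param e L phi /\ e `&` vertices = [set phi 0; phi L] ;
  edge_meet : forall e e', edges e -> edges e' -> e <> e' ->
    exists2 v, vertices v & e `&` e' `<=` [set v] ;
  tree_connected : forall u v, vertices u -> vertices v ->
    exists2 p : seq points, path (adjacent vertices edges) u p & last u p = v ;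
  tree_acyclic : forall c : seq points,
    cycle (adjacent vertices edges) c -> uniq c -> (size c <= 2)%N ;
  path_segment : forall p : R -> points,
    {within `[0, 1], continuous p} -> {in `[0, 1] &, injective p} ->
    isometric_to_segment (p @` `[0, 1])
}.
Arguments vertices : clear implicits.
Arguments edges : clear implicits.

Definition valence_ge2 (X : realSimplicialTree) :=
  forall v, vertices X v ->
    exists e e' : set X, [/\ edges X e, edges X e', e <> e', e v & e' v].

Definition is_isom (X : realSimplicialTree) (g : X -> X) :=
  [/\ bijective g,
      forall x y, mdist (g x) (g y) = mdist x y,
      forall v, vertices X v -> vertices X (g v) &
      forall e, edges X e -> edges X (g @` e)].

End RealSimplicialTree.
Arguments realSimplicialTree R : clear implicits.
Arguments vertices {R} r.
Arguments edges {R} r.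

Record isom (R : realType) (X : realSimplicialTree R) := Isom {
  isom_fun :> X -> X ;
  isomP : is_isom isom_fun
}.

Section IsomGroup.
Context {R : realType} {X : realSimplicialTree R}.
Implicit Types g h : isom X.

HB.instance Definition _ := gen_eqMixin (isom X).
HB.instance Definition _ := gen_choiceMixin (isom X).

Lemma isom_eq g h : g =1 h -> g = h.
Proof.
case: g h => [g gP] [h hP] /= /funext gh; rewrite -{}gh in hP *.
by rewrite (Prop_irrelevance gP hP).
Qed.

Lemma is_isom_id : is_isom (idfun : X -> X).
Proof. by split=> // e Ee; rewrite image_id. Qed.

Lemma is_isom_comp g h : is_isom (g \o h).
Proof.
have [gb gd gv ge] := isomP g; have [hb hd hv he] := isomP h.
split.
- exact: bij_comp.
- by move=> x y /=; rewrite gd hd.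
- by move=> v /hv /gv.
- by move=> e /he /ge; rewrite image_comp.
Qed.

Lemma isom_inv_subproof g :
  exists h : isom X, cancel h g /\ cancel g h.
Proof.
have [[k gK kK] gd gv ge] := isomP g.
suff kP : is_isom k by exists (Isom kP).
split.
- by exists g.
- by move=> x y; rewrite -gd !kK.
- move=> v Vv; have [//|[e Ee ekv]] := vertex_or_edge (k v).
  have [L [L0 [phi [[phiE phid] phiV]]]] := edge_segment Ee.
  have [L' [L0' [psi [[psiE psid] psiV]]]] := edge_segment (ge _ Ee).
  have phi0 : (e `&` vertices X) (phi 0) by rewrite phiV; left.
  have phiL : (e `&` vertices X) (phi L) by rewrite phiV; right.
  have phi0L : phi 0 <> phi L.
    move=> eq0L; have := phid 0 L.
    rewrite eq0L mdistxx sub0r normrN gtr0_norm// !in_itv/= !lexx (ltW L0).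
    by move=> /(_ isT isT) /esym/eqP; rewrite gt_eqF.
  have im x : e x -> vertices X (g x) -> g x = psi 0 \/ g x = psi L'.
    by move=> ex Vgx; have : (g @` e `&` vertices X) (g x) by []; rewrite psiV.
  have gi : injective g := can_inj gK.
  have im0 := im _ phi0.1 (gv _ phi0.2).
  have imL := im _ phiL.1 (gv _ phiL.2).
  have imv : g (k v) = psi 0 \/ g (k v) = psi L'.
    by apply: im => //; rewrite kK.
  suff : k v = phi 0 \/ k v = phi L by move=> [->|->]; [case: phi0|case: phiL].
  case: imv => iv; case: im0 => i0; case: imL => iL;
    try (by left; apply: gi; rewrite iv i0);
    try (by right; apply: gi; rewrite iv iL);
    by case: phi0L; apply: gi; rewrite i0 iL.
- move=> e' Ee'; have [L [L0 [phi [[phiE phid] phiV]]]] := edge_segment Ee'.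
  have L2 : L / 2 \in `[0, L].
    by rewrite in_itv/= divr_ge0 ?ltW//= ltr_pdivrMr// ltr_pMr// ltr1n.
  have em : e' (phi (L / 2)) by rewrite -phiE; exists (L / 2).
  have nVm : ~ vertices X (phi (L / 2)).
    move=> Vm; have : (e' `&` vertices X) (phi (L / 2)) by [].
    rewrite phiV => -[] eqm.
      have := phid (L / 2) 0 L2; rewrite eqm mdistxx subr0 in_itv/= lexx (ltW L0).
      by move=> /(_ isT) /esym/eqP; rewrite normr_eq0 gt_eqF// divr_gt0.
    have := phid (L / 2) L L2; rewrite eqm mdistxx in_itv/= lexx (ltW L0).
    move=> /(_ isT) /esym/eqP; rewrite normr_eq0 subr_eq0 lt_eqF//.
    by rewrite ltr_pdivrMr// ltr_pMr// ltr1n.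
  have [Vk|[e Ee ek]] := vertex_or_edge (k (phi (L / 2))).
    by case: nVm; rewrite -[phi _]kK; apply: gv.
  suff -> : e' = g @` e by rewrite image_comp (_ : k \o g = id) ?image_id//;
    apply/funext => x; exact: gK.
  apply: contrapT => ne.
  have [v Vv /(_ (phi (L / 2))) vE] := edge_meet Ee' (ge _ Ee) ne.
  apply: nVm; rewrite vE//; split=> //.
  by exists (k (phi (L / 2))) => //; rewrite kK.
Qed.

Definition isom_one : isom X := Isom is_isom_id.
Definition isom_mul g h : isom X := Isom (is_isom_comp g h).
Definition isom_inv g : isom X := sval (cid (isom_inv_subproof g)).

Let isom_mulA : associative isom_mul.
Proof. by move=> f g h; apply: isom_eq. Qed.

Let isom_mul1 : left_id isom_one isom_mul.
Proof. by move=> f; apply: isom_eq. Qed.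

Let isom_1mul : right_id isom_one isom_mul.
Proof. by move=> f; apply: isom_eq. Qed.

Let isom_mulV : left_inverse isom_one isom_inv isom_mul.
Proof.
move=> f; apply: isom_eq => x; rewrite /isom_inv.
by case: cid => h /= [_ fK]; rewrite fK.
Qed.

Let isom_mulrV : right_inverse isom_one isom_inv isom_mul.
Proof.
move=> f; apply: isom_eq => x; rewrite /isom_inv.
by case: cid => h /= [hK _]; rewrite hK.
Qed.

HB.instance Definition _ := isGroup.Build (isom X)
  isom_mulA isom_mul1 isom_1mul isom_mulV isom_mulrV.

End IsomGroup.

Section LipschitzMaps.
Context {R : realType}.
Implicit Types X : realSimplicialTree R.

(* [set h | h = g on K] is the coset of g by the pointwise stabilizer of K. *)
Definition isom_open X (U : set (isom X)) :=
  forall g, U g -> exists2 K : set X, compact K &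
    forall h : isom X, (forall x, K x -> h x = g x) -> U h.

Definition discrete_isoms X (G : set (isom X)) :=
  forall g, G g -> exists2 U, isom_open U & U `&` G = [set g].

Definition torsion_free X (G : set (isom X)) :=
  forall g n, G g -> (0 < n)%N -> (g ^+ n = 1)%g -> g = 1%g.

Definition vertex_orbits X (G : set (isom X)) : set (set X) :=
  [set [set g v | g in G] | v in vertices X].

Definition edge_orbits X (G : set (isom X)) : set (set (set X)) :=
  [set [set g @` e | g in G] | e in edges X].

Definition finite_quotient X (G : set (isom X)) :=
  finite_set (vertex_orbits G) /\ finite_set (edge_orbits G).

Definition transl_len X (g : isom X) : R :=
  inf [set mdist x (g x) | x in [set: X]].

Definition piecewise_affine X X' (f : X -> X') :=
  forall e, edges X e -> exists2 Ce : R, 0 <= Ce &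
    forall x1 x2, e x1 -> e x2 -> mdist (f x1) (f x2) = Ce * mdist x1 x2.

Definition equivariant X X' (G : set (isom X)) (rho : isom X -> isom X')
    (f : X -> X') :=
  forall g x, G g -> f (g x) = rho g (f x).

Definition lip_bounds X X' (f : X -> X') : set R :=
  [set k | 0 <= k /\ forall x y, mdist (f x) (f y) <= k * mdist x y].

Definition is_lipschitz X X' (f : X -> X') := lip_bounds f !=set0.

Definition lip_const X X' (f : X -> X') : R := inf (lip_bounds f).

Definition affine_maps X X' (G : set (isom X)) (rho : isom X -> isom X') :
    set (X -> X') :=
  [set f | piecewise_affine f /\ equivariant G rho f].

Definition min_lip X X' (G : set (isom X)) (rho : isom X -> isom X') : R :=
  inf [set lip_const f | f in affine_maps G rho].

Definition stretch X X' (rho : isom X -> isom X') (g : isom X) : R :=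
  transl_len (rho g) / transl_len g.

(* 4 * N counts edges, so it is converted into a length by a bound l on the
   lengths of the edges of X. With edges of length at most 1 one takes l = 1
   and gets the condition d (x0, g x0) <= 4 N; without any normalisation of
   the edge lengths that set may be empty (x |-> x + 100 on the real line with
   vertices in 100 Z, where N = 1). *)
Definition short_elements X (G : set (isom X)) (x0 : X) (N : nat) (l : R) :
    set (isom X) :=
  [set g | [/\ G g, g <> 1%g & mdist x0 (g x0) <= 4 * N%:R * l]].

End LipschitzMaps.

(* Main.v *)
Require Import Defs.
From HB Require Import structures.
From mathcomp Require Import all_boot all_order all_algebra.
From mathcomp Require Import all_classical all_reals all_analysis.
From mathcomp Require Import ring lra zify.

Set Implicit Arguments.
Unset Strict Implicit.
Unset Printing Implicit Defensive.

Import Order.TTheory GRing.Theory Num.Theory.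
Import numFieldNormedType.Exports.

Local Open Scope classical_set_scope.
Local Open Scope ring_scope.

(* Both trees are geodesic and satisfy the four-point condition, and convex
   subsets of such a space have the Helly property.

   Let [L] be the supremum of the stretches. The images of finitely many orbit
   representatives under an [L]-Lipschitz equivariant map are chosen one after
   the other: the image of a new point [v] must lie in balls around images
   already chosen and in the convex sets [{y | d(y, rho(h) y) <= L d(v, h v)}].
   Two such sets for [g] and [h] meet because otherwise the axes of [rho(g)] and
   [rho(h)] are so far apart that [lambda(rho(g h)) > L (d(v, g v) + d(v, h v))
   >= L lambda(g h)]. No local compactness or completeness of the target is
   needed, since only finitely many [h] matter at each step.

   If an edge path of [2N] edges is stretched by exactly [L], three of its
   vertices are in one orbit, and one of the three elements of the group joining
   them has stretch [L]. If there is no such path, finiteness of the set of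
   paths modulo the group bounds all stretches by some [K < L]. *)

(** The inequality [L] <= C needs no construction: at a point where g realises its translation
    length, a k-Lipschitz equivariant map shows lambda(rho(g)) <= k lambda(g). So a single map with
    constant [L] settles both the value of C and its attainment, with no limit of maps. Its
    Lipschitz bound has to be checked on the ends of edges only, since the map extends affinely and
    the bound adds up along geodesics.

    The action on [X] is free, because a fixed point gives translation length 0. With finitely many
    edge orbits, balls then contain finitely many vertices, and finitely many elements move a given
    point by a bounded distance; hence the finite families to which Helly is applied.

    The constants: a path of 2N edges has 2N + 1 vertices in N orbits, so three of them share an
    orbit. Stretch is invariant under conjugation, and every point is within N l of each vertex
    orbit, so an element moving a vertex by at most 2N l has a conjugate moving [x0] by at most N l
    + 2N l + N l. *)

Section Geodesics.
Context {R : realType} {X : realSimplicialTree R}.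
Implicit Types (x y z w : X) (phi psi : R -> X) (D s t u : R).
Local Notation d := (@mdist R X).

(** * Geodesic parametrisations, their concatenation, and the four-point condition *)

Definition geod phi D x y :=
  [/\ 0 <= D, phi 0 = x, phi D = y &
      forall s t, 0 <= s -> s <= t -> t <= D -> d (phi s) (phi t) = t - s].

Lemma segment_param_geod (A : set X) L phi : 0 <= L ->
  segment_param A L phi -> geod phi L (phi 0) (phi L).
Proof.
move=> L0 [_ h]; split=> // s t s0 st tL.
rewrite h ?in_itv /=; [|lra..].
by rewrite ler0_norm; lra.
Qed.

Lemma geod_mdist phi D x y : geod phi D x y -> d x y = D.
Proof. by case=> D0 <- <- h; rewrite h ?subr0. Qed.

Lemma geod_rev phi D x y : geod phi D x y -> geod (fun u => phi (D - u)) D y x.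
Proof.
case=> D0 <- <- h; split; rewrite ?subr0 ?subrr// => s t s0 st tD.
by rewrite metric_sym h; lra.
Qed.

Lemma geod_sub phi D x y a b : geod phi D x y -> 0 <= a -> a <= b -> b <= D ->
  geod (fun u => phi (a + u)) (b - a) (phi a) (phi b).
Proof.
case=> D0 _ _ h a0 ab bD; split; rewrite ?addr0 ?subr_ge0 ?subrKC// => s t s0 st tD.
by rewrite h; lra.
Qed.

Definition glue phi psi D u := if u <= D then phi u else psi (u - D).

Lemma glueR phi psi D u : phi D = psi 0 -> D <= u -> glue phi psi D u = psi (u - D).
Proof.
rewrite /glue => e Du; case: ifPn => // uD.
by have -> : u = D by [lra]; rewrite subrr.
Qed.

Lemma glue_lip phi psi D D' x y z s t : geod phi D x y -> geod psi D' y z ->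
  0 <= s -> s <= t -> t <= D + D' ->
  d (glue phi psi D s) (glue phi psi D t) <= t - s.
Proof.
move=> [D0 phi0 phiD hphi] [D0' psi0 psiD hpsi] s0 st tD.
have [tD'|tD'] := lerP t D.
  by rewrite /glue tD' ifT ?hphi//; lra.
have e : phi D = psi 0 by rewrite phiD psi0.
have [sD|sD] := lerP D s.
  by rewrite !glueR//; [rewrite hpsi; lra|lra].
rewrite [X in d X]/glue (ltW sD) [X in d _ X]glueR//; last by lra.
apply: (le_trans (metric_triangle _ (phi D) _)).
by rewrite hphi//; [rewrite e hpsi; lra|lra].
Qed.

Lemma lip_within_continuous (T : metricType R) (p : R -> T) (K L : R) :
  (forall s t, 0 <= s -> s <= t -> t <= L -> mdist (p s) (p t) <= K * (t - s)) ->
  {within `[0, L], continuous p}.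
Proof.
move=> h; apply/subspace_continuousP => s; rewrite /= in_itv/= => /andP[s0 sL].
apply/metricType_numDomainType.cvgrPdist_lt => e e0; rewrite near_withinE.
have [a aE] : exists a, a = `|K| by exists `|K|.
have Ka : K <= a by rewrite aE ler_norm.
have a0 : 0 < a + 1 by rewrite aE ltr_wpDl.
have ek : 0 < e / (a + 1) by rewrite divr_gt0.
near=> t; rewrite /= in_itv/= => /andP[t0 tL].
have : `|s - t| < e / (a + 1) by near: t; apply: cvgr_dist_lt.
rewrite ltr_pdivlMr// mulrC mulrDl mul1r => hst; apply: le_lt_trans hst.
have [st|ts] := lerP s t; first by apply: le_trans (h _ _ s0 st tL) _; nra.
by rewrite metric_sym; apply: le_trans (h _ _ t0 (ltW ts) sL) _; nra.
Unshelve. all: by end_near.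
Qed.

Lemma real_btw_uniq (a b c c' : R) : `|a - c| + `|c - b| = `|a - b| ->
  `|a - c'| = `|a - c| -> `|c' - b| = `|c - b| -> c' = c.
Proof.
have [?|?] := lerP a c; have [?|?] := lerP c b; have [?|?] := lerP a b;
  have [?|?] := lerP a c'; have [?|?] := lerP c' b; lra.
Qed.

Lemma real_btw_cases (a b c : R) :
  [\/ `|a - c| = `|a - b| + `|b - c|, `|b - c| = `|a - b| + `|a - c| |
       `|a - b| = `|a - c| + `|b - c|].
Proof.
have [?|?] := lerP a c; have [?|?] := lerP b c; have [?|?] := lerP a b;
  by [apply: Or31; lra|apply: Or32; lra|apply: Or33; lra].
Qed.

Lemma isometric_coord (S : set X) : isometric_to_segment S ->
  exists kappa : X -> R, forall x y, S x -> S y -> d x y = `|kappa x - kappa y|.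
Proof.
case=> L [L0 [chi [chiS hchi]]].
have H x : exists k, S x -> k \in `[0, L] /\ chi k = x.
  have [Sx|nSx] := pselect (S x); last by exists 0.
  by move: Sx; rewrite -chiS => -[k /= kL <-]; exists k.
have /choice[kappa hk] := H.
exists kappa => x y Sx Sy.
have [kx ex] := hk _ Sx; have [ky ey] := hk _ Sy.
by rewrite -{1}ex -{1}ey hchi.
Qed.

(** The concatenation, rescaled to [0, 1], is an injective path, so [path_segment] gives its points
    real coordinates. Of three reals one lies between the other two. If that one is not [y], the far
    end of the shorter piece coincides with the point of the longer piece at the same distance from
    [y], which [disj] allows only for a piece of length 0. *)
Lemma geod_cat phi psi D D' x y z : geod phi D x y -> geod psi D' y z ->
  (forall s t, 0 <= s <= D -> 0 <= t <= D' -> phi s = psi t -> t = 0) ->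
  d x z = D + D'.
Proof.
move=> gphi gpsi disj; move: (gphi) (gpsi).
move=> [D0 phi0 phiD hphi] [D0' psi0 psiD hpsi].
have [DD0|DD0] := eqVneq (D + D') 0.
  have e0 : D = 0 by lra.
  have e0' : D' = 0 by lra.
  by move: phiD psiD; rewrite e0 e0' phi0 psi0 => -> ->; rewrite mdistxx addr0.
have DDp : 0 < D + D' by rewrite lt_def DD0 addr_ge0.
have e : phi D = psi 0 by rewrite phiD psi0.
pose p u := glue phi psi D (u * (D + D')).
have pc : {within `[0, 1], continuous p}.
  apply: (@lip_within_continuous _ _ (D + D')) => s t s0 st t1.
  apply: le_trans (glue_lip gphi gpsi _ _ _) _; [nra|nra|nra|].
  by rewrite -mulrBl mulrC.
have pinj : {in `[0, 1] &, injective p}.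
  have W s t : 0 <= s -> s <= t -> t <= D + D' ->
      glue phi psi D s = glue phi psi D t -> s = t.
    move=> s0 st tD.
    have [tD'|tD'] := lerP t D.
      rewrite /glue tD' ifT; last by lra.
      by move=> eq; have := hphi s t s0 st tD'; rewrite eq mdistxx; lra.
    have [sD|sD] := lerP D s.
      rewrite !glueR//; last lra.
      move=> eq; have := hpsi (s - D) (t - D); rewrite eq mdistxx => h.
      by have : 0 = t - D - (s - D) by [apply: h; lra]; lra.
    rewrite [X in X = _]/glue (ltW sD) glueR//; last by lra.
    by move=> /(disj _ _ _ _) => h; have : t - D = 0 by [apply: h; lra]; lra.
  move=> s t; rewrite !in_itv/= => /andP[s0 s1] /andP[t0 t1]; rewrite /p => eq.
  apply: (mulIf DD0).
  by have [st|ts] := lerP s t; [apply: W eq|apply/esym; apply: W (esym eq)]; nra.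
have [kappa hk] := isometric_coord (path_segment pc pinj).
set S := p @` _ in hk.
have Sg u : 0 <= u -> u <= D + D' -> S (glue phi psi D u).
  move=> u0 uD; exists (u / (D + D')); last by rewrite /p divfK.
  by rewrite /= in_itv/= divr_ge0 ?ler_pdivrMr ?mul1r// ltW.
have Sphi u : 0 <= u -> u <= D -> S (phi u).
  by move=> u0 uD; have := Sg u; rewrite /glue uD; apply; lra.
have Spsi u : 0 <= u -> u <= D' -> S (psi u).
  move=> u0 uD; have := Sg (D + u); rewrite glueR//; last by lra.
  by rewrite addrAC subrr add0r; apply; lra.
have dxy := geod_mdist gphi; have dyz := geod_mdist gpsi.
have Sx : S x by rewrite -phi0; apply: Sphi.
have Sy : S y by rewrite -psi0; apply: Spsi.
have Sz : S z by rewrite -psiD; apply: Spsi.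
have kxy := hk _ _ Sx Sy; have kyz := hk _ _ Sy Sz; have kxz := hk _ _ Sx Sz.
have xz0 := mdist_ge0 x z.
have key1 : D <= D' -> d y z = d y x + d x z -> D = 0.
  move=> DD' bt.
  have dyx : d y x = D by rewrite metric_sym.
  apply: (disj 0 D); [lra|lra|rewrite phi0].
  have Sw := Spsi D D0 DD'.
  apply: mdist_positivity; rewrite hk//.
  have := hpsi 0 D; rewrite psi0 => /(_ _ _ _) h1.
  have {}h1 : d y (psi D) = D - 0 by apply: h1; lra.
  have h2 : d (psi D) z = D' - D by rewrite -psiD hpsi//; lra.
  have -> : kappa x = kappa (psi D).
    by apply: (@real_btw_uniq (kappa y) (kappa z)); rewrite -!hk//; lra.
  by rewrite subrr normr0.
have key2 : D' <= D -> d x y = d x z + d z y -> D' = 0.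
  move=> DD' bt.
  have dzy : d z y = D' by rewrite metric_sym.
  apply: (disj (D - D') D'); [lra|lra|rewrite psiD].
  have Sw : S (phi (D - D')) by apply: Sphi; lra.
  apply: mdist_positivity; rewrite hk//.
  have h1 : d x (phi (D - D')) = D - D' by rewrite -phi0 hphi//; lra.
  have h2 : d (phi (D - D')) y = D' by rewrite -phiD hphi//; lra.
  have -> : kappa z = kappa (phi (D - D')).
    by apply: (@real_btw_uniq (kappa x) (kappa y)); rewrite -!hk//; lra.
  by rewrite subrr normr0.
have dyx := metric_sym y x; have dzy := metric_sym z y.
have := real_btw_cases (kappa x) (kappa y) (kappa z); rewrite -!hk// => -[|h|h].
- by rewrite dxy dyz.
- by have : D = 0 by [apply: key1; lra]; have := metric_sym x z; lra.
- by have : D' = 0 by [apply: key2; lra]; lra.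
Qed.

Lemma geod_glue phi psi D D' x y z : geod phi D x y -> geod psi D' y z ->
  d x z = D + D' -> geod (glue phi psi D) (D + D') x z.
Proof.
move=> gphi gpsi dxz; move: (gphi) (gpsi).
move=> [D0 phi0 phiD hphi] [D0' psi0 psiD hpsi].
have e : phi D = psi 0 by rewrite phiD psi0.
have gx : glue phi psi D 0 = x by rewrite /glue D0.
have gz : glue phi psi D (D + D') = z by rewrite glueR ?lerDl// addrAC subrr add0r.
split=> //; [exact: addr_ge0|move=> s t s0 st tD].
have := glue_lip gphi gpsi s0 st tD.
have h0s : d (glue phi psi D 0) (glue phi psi D s) <= s - 0.
  by apply: (glue_lip gphi gpsi); lra.
have htD : d (glue phi psi D t) (glue phi psi D (D + D')) <= D + D' - t.
  by apply: (glue_lip gphi gpsi); lra.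
rewrite gx gz in h0s htD.
have := metric_triangle x (glue phi psi D s) z.
have := metric_triangle (glue phi psi D s) (glue phi psi D t) z.
lra.
Qed.

Lemma first_hit phi psi D D' x y z : geod phi D x y -> geod psi D' z y ->
  exists s t, [/\ 0 <= s <= D, 0 <= t <= D', psi t = phi s &
    forall s' t', 0 <= s' <= D -> 0 <= t' -> t' < t -> psi t' <> phi s'].
Proof.
move=> gphi gpsi; move: (gphi) (gpsi).
move=> [D0 phi0 phiD hphi] [D0' psi0 psiD hpsi].
pose A := [set t | 0 <= t <= D' /\ exists s, 0 <= s <= D /\ psi t = phi s].
have AD' : A D' by split; [lra|exists D; rewrite phiD psiD; split=> //; lra].
have Ainf : has_inf A.
  by split; [exists D'|exists 0 => t [/andP[]]].
have lb t : A t -> inf A <= t by move=> At; apply: ge_inf => //; exact: Ainf.2.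
have t0 : 0 <= inf A by apply: lb_le_inf; [exists D'|move=> t [/andP[]]].
have tD := lb _ AD'.
have dist t s : 0 <= t <= D' -> 0 <= s <= D' -> d (psi t) (psi s) = `|t - s|.
  move=> /andP[? ?] /andP[? ?]; have [ts|st] := lerP t s.
    by rewrite hpsi// ler0_norm; lra.
  by rewrite metric_sym hpsi ?gtr0_norm; lra.
have close e : 0 < e -> exists2 t, A t & inf A <= t < inf A + e.
  move=> e0; have [t At te] := inf_adherent e0 Ainf.
  by exists t => //; rewrite lb.
set tt := inf A in lb t0 tD close *.
(* A point of [phi] has its distance to [x] as parameter. This names the limit parameter at once,
   without extracting a convergent sequence. *)
pose ss := d x (psi tt).
have ssD : ss <= D.
  apply/ler_addgt0Pr => e e0; have [t [tD' [s [sD E]]] te] := close e e0.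
  have : ss <= d x (psi t) + d (psi t) (psi tt) by exact: metric_triangle.
  have -> : d (psi t) (psi tt) = t - tt by rewrite metric_sym hpsi; lra.
  have -> : d x (psi t) = s by rewrite E -phi0 hphi; lra.
  lra.
have ss0 : 0 <= ss by exact: mdist_ge0.
have hit : psi tt = phi ss.
  apply: mdist_positivity; apply/eqP; rewrite eq_le mdist_ge0 andbT.
  apply/ler_addgt0Pr => e e0.
  have [|t [tD' [s [sD E]]] te] := close (e / 2); first lra.
  rewrite add0r.
  have h1 : d (psi tt) (psi t) = t - tt by rewrite hpsi; lra.
  have h2 : d x (psi t) = s by rewrite E -phi0 hphi; lra.
  have h3 := metric_triangle x (psi t) (psi tt).
  have h4 := metric_triangle x (psi tt) (psi t).
  have h5 := metric_triangle (psi tt) (psi t) (phi ss).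
  rewrite (metric_sym (psi t) (psi tt)) -/ss in h3.
  rewrite -/ss in h4.
  have [le|le] := lerP s ss.
    have : d (psi t) (phi ss) = ss - s by rewrite E hphi; lra.
    lra.
  have : d (psi t) (phi ss) = s - ss by rewrite E metric_sym hphi; lra.
  lra.
exists ss, tt; split=> //; [lra|lra|].
move=> s' t' s'D t'0 t't eq.
have : A t' by split; [lra|exists s'].
by move=> /lb; lra.
Qed.

(** Cut [psi] at its first point on [phi]. Each half of [phi] meets the cut piece in that point
    only, so [geod_cat] applies twice. The geodesic from [z] to [x] obtained on the way makes
    [gconn] transitive. *)
Lemma geod_tripod phi psi D D' x y z : geod phi D x y -> geod psi D' z y ->
  exists s, [/\ 0 <= s <= D, d z y = d z (phi s) + (D - s) &
     exists chi, geod chi (d z (phi s) + s) z x].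
Proof.
move=> gphi gpsi; move: (gphi) (gpsi).
move=> [D0 phi0 phiD hphi] [D0' psi0 psiD hpsi].
have [s [t [/andP[s0 sD] /andP[t0 tD] E first]]] := first_hit gphi gpsi.
have g1 := geod_sub gpsi (lexx 0) t0 tD.
have gx := geod_sub gphi (lexx 0) s0 sD.
have gy := geod_sub gphi s0 sD (lexx D).
have gx' := geod_rev gx.
rewrite phi0 phiD !subr0 psi0 E in g1 gx gy gx'.
have disj u : 0 <= u <= t -> forall v, 0 <= v <= D -> psi (0 + u) = phi v -> v = s.
  move=> /andP[u0 ut] v vD; rewrite add0r => eq.
  have : u = t.
    by apply/eqP; rewrite eq_le ut/= leNgt; apply/negP => ltut; apply: first eq.
  move=> eut; rewrite eut E in eq.
  have [sv|vs] := lerP s v.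
    by have := hphi s v; rewrite eq mdistxx => h; have : 0 = v - s by [apply: h; lra]; lra.
  by have := hphi v s; rewrite eq mdistxx => h; have : 0 = s - v by [apply: h; lra]; lra.
have e1 : d z x = t + s.
  apply: (geod_cat g1 gx') => u v uD vD eq.
  have : 0 + (s - v) = s by apply: (disj u) => //; lra.
  lra.
have e2 : d z y = t + (D - s).
  apply: (geod_cat g1 gy) => u v uD vD eq.
  have : s + v = s by apply: (disj u) => //; lra.
  lra.
have e3 : d z (phi s) = t by exact: geod_mdist g1.
exists s; split; [lra|lra|].
by exists (glue (fun u => psi (0 + u)) (fun u => phi (0 + (s - u))) t); rewrite e3; exact: geod_glue g1 gx' e1.
Qed.

Definition gconn x y := exists phi D, geod phi D x y.

Lemma gconn_sym x y : gconn x y -> gconn y x.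
Proof. by move=> [phi [D /geod_rev g]]; exists (fun u => phi (D - u)), D. Qed.

Lemma gconn_trans y x z : gconn x y -> gconn y z -> gconn x z.
Proof.
move=> [phi [D g]] /gconn_sym[psi [D' g']].
have [s [_ _ [chi gchi]]] := geod_tripod g g'.
apply: gconn_sym; by exists chi, (d z (phi s) + s).
Qed.

Lemma gconn_edge (e : set X) x y : edges X e -> e x -> e y -> gconn x y.
Proof.
move=> Ee; have [L [L0 [phi [sp _]]]] := edge_segment Ee.
have g := segment_param_geod (ltW L0) sp.
have [phiE hphi] := sp; rewrite -phiE => -[s /= sL <-] [t /= tL <-].
rewrite in_itv/= in sL; rewrite in_itv/= in tL.
have W a b : 0 <= a -> a <= b -> b <= L -> gconn (phi a) (phi b).
  by move=> a0 ab bL; have := geod_sub g a0 ab bL; exists (fun u => phi (a + u)), (b - a).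
have [st|ts] := lerP s t; first by apply: W; lra.
by apply: gconn_sym; apply: W; lra.
Qed.

Lemma gconn_vertices (u v : X) : vertices X u -> vertices X v -> gconn u v.
Proof.
move=> Vu Vv; have [p pp <-] := tree_connected Vu Vv.
elim: p u Vu pp => [|w p IH] u Vu /=.
  by exists (fun=> u), 0; split=> // s t s0 st t0; rewrite mdistxx; lra.
move=> /andP[/asboolP[_ _ Vw [e Ee [eu ew]]] pp].
by apply: gconn_trans (IH _ Vw pp); exact: gconn_edge Ee eu ew.
Qed.

Lemma edge_endpoint (e : set X) : edges X e -> exists2 v, vertices X v & e v.
Proof.
move=> Ee; have [L [L0 [phi [sp V]]]] := edge_segment Ee.
have : (e `&` vertices X) (phi 0) by rewrite V; left.
by case=> ? ?; exists (phi 0).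
Qed.

Lemma gconn_all x y : gconn x y.
Proof.
have W x' : exists2 v, vertices X v & gconn x' v.
  have [Vx|[e Ee ex]] := vertex_or_edge x'.
    by exists x' => //; exact: gconn_vertices.
  have [v Vv ev] := edge_endpoint Ee; exists v => //; exact: gconn_edge Ee ex ev.
have [u Vu xu] := W x; have [v Vv yv] := W y.
apply: gconn_trans xu _; apply: gconn_trans (gconn_vertices Vu Vv) _.
exact: gconn_sym.
Qed.

Lemma geodP x y : exists phi, geod phi (d x y) x y.
Proof. by have [phi [D g]] := gconn_all x y; exists phi; rewrite (geod_mdist g). Qed.

(* Four points project onto a geodesic between two of them. *)
Lemma mdist_4pt x y z w :
  d x y + d z w <= d x z + d y w \/ d x y + d z w <= d x w + d y z.
Proof.
have [phi g] := geodP x y.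
have P z' : exists s, [/\ 0 <= s <= d x y, d z' y = d z' (phi s) + (d x y - s) &
    d z' x = d z' (phi s) + s].
  have [psi gpsi] := geodP z' y.
  have [s [s0 e [chi gchi]]] := geod_tripod g gpsi.
  by exists s; split=> //; exact: geod_mdist gchi.
have [s [sD zy zx]] := P z; have [t [tD wy wx]] := P w.
have t1 := metric_triangle z (phi s) w.
have t2 := metric_triangle (phi s) (phi t) w.
have [_ _ _ h] := g.
rewrite (metric_sym x z) (metric_sym y w) (metric_sym x w) (metric_sym y z).
rewrite (metric_sym (phi t) w) in t2.
have [st|ts] := lerP s t.
  right; have : d (phi s) (phi t) = t - s by apply: h; lra.
  lra.
left; have : d (phi s) (phi t) = s - t by rewrite metric_sym; apply: h; lra.
lra.
Qed.

End Geodesics.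

(** * Real trees and their isometries *)

Section MetricTree.
Context {R : realType} {X : realSimplicialTree R}.
Implicit Types (x y z w m o p q : X) (g h a b : isom X) (s t c : R).
Local Notation d := (@mdist R X).

Lemma isom_mdist g x y : d (g x) (g y) = d x y.
Proof. by case: (isomP g). Qed.

Lemma isom_mulE g h x : (g * h)%g x = g (h x). Proof. by []. Qed.

Lemma isomVK g x : g (g^-1%g x) = x.
Proof. by rewrite -isom_mulE mulgV. Qed.

Lemma isomKV g x : g^-1%g (g x) = x.
Proof. by rewrite -isom_mulE mulVg. Qed.

Lemma isom_mdistV g x y : d (g^-1%g x) y = d x (g y).
Proof. by rewrite -(isom_mdist g) isomVK. Qed.

Lemma mdist_self_isomV g x : d x (g^-1%g x) = d x (g x).
Proof. by rewrite metric_sym isom_mdistV. Qed.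

(** Membership in a segment is put in metric form, so that facts about segments become linear
    arithmetic over instances of [mdist_4pt]. *)
Definition btw x z y := d x z + d z y = d x y.

Lemma btw_sym x z y : btw x z y -> btw y z x.
Proof. by rewrite /btw addrC (metric_sym y z) (metric_sym z x) (metric_sym y x). Qed.

Lemma isom_btw g x z y : btw x z y -> btw (g x) (g z) (g y).
Proof. by rewrite /btw !isom_mdist. Qed.

Lemma geod_btw phi D x y s : geod phi D x y -> 0 <= s -> s <= D ->
  btw x (phi s) y.
Proof.
move=> g s0 sD; rewrite /btw (geod_mdist g); have [_ e0 eD h] := g.
have h1 : d x (phi s) = s by rewrite -[X in d X _]e0 h; lra.
have h2 : d (phi s) y = D - s by rewrite -eD h; lra.
lra.
Qed.

Lemma btw_uniq x y z z' :
  btw x z y -> d x z' = d x z -> d z' y = d z y -> z' = z.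
Proof.
rewrite /btw => b1 e1 e2; apply: mdist_positivity.
have := mdist_4pt x y z' z; have := mdist_ge0 z' z.
have := metric_sym y z; have := metric_sym y z'; lra.
Qed.

Lemma btw_ex x y t : 0 <= t -> t <= d x y ->
  exists z, [/\ btw x z y, d x z = t & d z y = d x y - t].
Proof.
move=> t0 tD; have [phi [_ e0 eD h]] := geodP x y; exists (phi t).
have h1 : d x (phi t) = t by rewrite -{1}e0 h; lra.
have h2 : d (phi t) y = d x y - t by rewrite -[X in d _ X]eD h; lra.
by split=> //; rewrite /btw; lra.
Qed.

Lemma btw_mdist x y z z' : btw x z y -> btw x z' y -> d x z <= d x z' ->
  d z z' = d x z' - d x z.
Proof.
rewrite /btw => b1 b2 le.
have := mdist_4pt x y z z'; have := metric_triangle x z z'.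
have := metric_sym y z; have := metric_sym y z'; lra.
Qed.

Lemma btw_chain x y z w : btw x y z -> btw y z w -> y <> z ->
  btw x y w /\ btw x z w.
Proof.
rewrite /btw => b1 b2 /eqP; rewrite -mdist_gt0 => yz.
have := mdist_4pt x z y w; have := metric_triangle x y w.
have := metric_sym z y; lra.
Qed.

Lemma median_ex x y z : exists m, [/\ btw x m y, btw y m z & btw x m z].
Proof.
have t1 := metric_triangle y x z; have t2 := metric_triangle x y z.
have t3 := metric_triangle x z y.
have sy := metric_sym x y; have sz := metric_sym z y.
(* The prescribed distance is the Gromov product of [y] and [z] at [x], the length that the segments
   from [x] to them share. *)
have [||m [bm xm my]] := @btw_ex x y ((d x y + d x z - d y z) / 2); [lra|lra|].
exists m; rewrite /btw in bm *.
have f4 := mdist_4pt x y m z.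
have t4 := metric_triangle x m z; have t5 := metric_triangle y m z.
have := metric_sym y m.
by split; lra.
Qed.

(* [same o x y]: the segments from [o] to [x] and to [y] share an initial
   subsegment, i.e. the Gromov product of [x] and [y] at [o] is positive. *)
Definition same o x y := d x y < d o x + d o y.

Lemma same_sym o x y : same o x y -> same o y x.
Proof. by rewrite /same addrC (metric_sym y). Qed.

Lemma same_trans o x y z : same o x y -> same o y z -> same o x z.
Proof.
rewrite /same => h1 h2; have := mdist_4pt o y x z.
have := metric_sym y z; have := metric_sym y x; lra.
Qed.

Lemma btw_same o x y : btw x o y <-> ~ same o x y.
Proof.
rewrite /btw /same (metric_sym o x); have := metric_triangle x o y.
by split=> [?|/negP]; [lra|rewrite -leNgt; lra].
Qed.

(** * Convex sets and the Helly property *)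

Definition convex (A : set X) :=
  forall x y z, A x -> A y -> btw x z y -> A z.

Lemma convex_ball p c : convex [set x | d p x <= c].
Proof.
move=> x y z /= hx hy; rewrite /btw => bz; have := mdist_4pt x y z p.
have := metric_sym z p; have := metric_sym x p; have := metric_sym y p.
have := mdist_ge0 x z; have := mdist_ge0 z y; have := metric_sym y z.
lra.
Qed.

Lemma convex_disp g c : convex [set x | d x (g x) <= c].
Proof.
move=> x y z /= hx hy bz; have gbz := isom_btw g bz.
have f1 := mdist_4pt x y z (g z).
have f2 := mdist_4pt (g x) (g y) (g z) x.
have f3 := mdist_4pt (g x) (g y) (g z) y.
have t1 := metric_triangle x y (g y); have t2 := metric_triangle y x (g x).
have ge1 := mdist_ge0 x z; have ge2 := mdist_ge0 z y.
rewrite /btw !isom_mdist in bz gbz f1 f2 f3.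
have := metric_sym (g z) x; have := metric_sym (g z) y.
have := metric_sym (g x) x; have := metric_sym (g y) y.
have := metric_sym (g x) y; have := metric_sym (g y) x.
have := metric_sym y z; have := metric_sym x y.
lra.
Qed.

(** The first set is absorbed into all the others. The new sets still meet pairwise: given one point
    in each of the three pairwise intersections of three sets, their median lies, for each set,
    between two points of that set. *)
Lemma helly (I : eqType) (s : seq I) (F : I -> set X) :
  (forall i, i \in s -> convex (F i)) ->
  (forall i j, i \in s -> j \in s -> F i `&` F j !=set0) ->
  exists z, forall i, i \in s -> F i z.
Proof.
elim: s F => [|i s IH] F cvx meet.
  by have [v _] := vertices_neq0 X; exists v.
have ii : i \in i :: s by rewrite mem_head.
have js j : j \in s -> j \in i :: s by rewrite inE orbC => ->.
(* With an empty tail the induction hypothesis would say nothing about [F i]. *)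
have [->|sN0] := eqVneq s [::].
  by have [z [Fz _]] := meet i i ii ii; exists z => j /[!inE] /eqP ->.
have [||z Hz] := IH (fun j => F i `&` F j).
- move=> j /js js' x y z [ix jx] [iy jy] b.
  by split; [exact: (cvx i ii x y)|exact: (cvx j js' x y)].
- move=> j k /js js' /js ks'.
  have [x [jx kx]] := meet j k js' ks'.
  have [y [iy jy]] := meet i j ii js'.
  have [w [iw kw]] := meet i k ii ks'.
  have [m [b1 b2 b3]] := median_ex x y w.
  exists m; split; split;
    by [exact: (cvx i ii y w)|exact: (cvx j js' x y)|exact: (cvx k ks' x w)].
exists z => j; rewrite inE => /orP[/eqP ->|/Hz[]//].
by case: s sN0 Hz {IH meet cvx ii js} => // k s _ /(_ k (mem_head _ _)) [].
Qed.

(** * Translation lengths *)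

Lemma transl_len_le g x : transl_len g <= d x (g x).
Proof.
apply: ge_inf; last by exists x.
by exists 0 => _ [y _ <-]; exact: mdist_ge0.
Qed.

Lemma transl_len_lb g c : (forall x, c <= d x (g x)) -> c <= transl_len g.
Proof.
move=> h; apply: lb_le_inf; last by move=> _ [y _ <-].
by have [v _] := vertices_neq0 X; exists (d v (g v)), v.
Qed.

Lemma transl_len_ge0 g : 0 <= transl_len g.
Proof. by apply: transl_len_lb => x; exact: mdist_ge0. Qed.

Lemma transl_len1 : transl_len (1 : isom X)%g = 0.
Proof.
apply/eqP; rewrite eq_le transl_len_ge0 andbT.
have [v _] := vertices_neq0 X.
by rewrite (le_trans (transl_len_le _ v))// mdistxx.
Qed.

Lemma mdist_iter g n x y : d (iter n g x) (iter n g y) = d x y.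
Proof. by elim: n => //= n IH; rewrite isom_mdist. Qed.

Lemma mdist_iter_le g x n : d x (iter n g x) <= n%:R * d x (g x).
Proof.
elim: n => [|n IH]; first by rewrite mdistxx mul0r.
rewrite -natr1 mulrDl mul1r iterS.
apply: le_trans (metric_triangle _ (g x) _) _.
by rewrite isom_mdist addrC lerD2r.
Qed.

(** The four-point condition on [x], [g x] and two consecutive later iterates makes the distances
    from [x] to its iterates a convex sequence, so each increment is at least the first one, [u]. *)
Lemma mdist_iter_ge g x n : d x (g x) < d x (g (g x)) ->
  d x (g x) + n%:R * (d x (g (g x)) - d x (g x)) <= d x (iter n.+1 g x).
Proof.
set u := d x (g (g x)) - d x (g x) => gx.
have u0 : 0 < u by rewrite subr_gt0.
pose D k := d x (iter k g x).
suff [] : d x (g x) + n%:R * u <= D n.+1 /\ D n.+1 + u <= D n.+2 by [].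
elim: n => [|n [IH1 IH2]]; first by rewrite mul0r addr0 /D /u/=; split; lra.
have IH3 : d x (g x) + n.+1%:R * u <= D n.+2.
  by rewrite -natr1 mulrDl mul1r; lra.
split=> //.
have f4 := mdist_4pt x (iter n.+2 g x) (g x) (iter n.+3 g x).
have e1 : d (g x) (iter n.+3 g x) = D n.+2 by rewrite iterS isom_mdist.
have e2 : d (iter n.+2 g x) (iter n.+3 g x) = d x (g x).
  by rewrite -(mdist_iter g n.+2 x (g x)) -iterSr.
have e3 : d (iter n.+2 g x) (g x) = D n.+1 by rewrite metric_sym iterS isom_mdist.
rewrite e1 e2 e3 -/(D n.+2) -/(D n.+3) in f4.
have : d x (g x) < d x (g x) + n.+1%:R * u by rewrite ltrDl mulr_gt0 ?ltr0n.
lra.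
Qed.

(** If positive, the left side is the least speed at which the iterates of [x] recede, whereas those
    of [y] recede at speed at most [d y (g y)]. Corresponding iterates stay [d x y] apart, so a
    large [n] compares the two speeds. *)
Lemma transl_len_ge g x : d x (g (g x)) - d x (g x) <= transl_len g.
Proof.
set u := _ - _; have [u0|u0] := lerP u 0; first exact: le_trans (transl_len_ge0 g).
apply: transl_len_lb => y.
rewrite leNgt; apply/negP => yu.
have [n nP] : exists n : nat, 2 * d x y < n%:R * (u - d y (g y)).
  exists (Num.bound (2 * d x y / (u - d y (g y)))).
  rewrite -ltr_pdivrMr ?subr_gt0//; apply: le_lt_trans (archi_boundP _); last first.
    by rewrite divr_ge0 ?mulr_ge0 ?mdist_ge0// subr_ge0 ltW.
  by rewrite lexx.
have := @mdist_iter_ge g x n; rewrite -subr_gt0 => /(_ u0); rewrite -/u => h1.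
have h2 := mdist_iter_le g y n.+1.
have t1 := metric_triangle x y (iter n.+1 g x).
have t2 := metric_triangle y (iter n.+1 g y) (iter n.+1 g x).
have t3 := metric_triangle x (g x) (g (g x)).
have sy := metric_sym y x.
rewrite mdist_iter in t2; rewrite isom_mdist in t3.
rewrite -natr1 mulrDl mul1r in h2; rewrite mulrBr in nP.
by rewrite /u in yu nP h1; lra.
Qed.

(** Walking from [x] towards [g x] lowers the displacement at full rate 2, until it is below a
    quantity that [transl_len_ge] bounds by the translation length. *)
Lemma disp_shrink g x s : 0 <= s -> 2 * s <= d x (g x) ->
  exists2 w, d x w = s &
    d w (g w) <= d x (g x) - 2 * s \/ d w (g w) <= d x (g (g x)) - d x (g x).
Proof.
move=> s0 sD; have [||w [bw xw wgx]] := @btw_ex x (g x) s; [lra|lra|].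
exists w => //.
have f1 := mdist_4pt x (g x) w (g w).
have f2 := mdist_4pt (g x) (g (g x)) (g w) x.
rewrite !isom_mdist in f1 f2.
have := metric_sym (g x) w; have := metric_sym (g x) x.
have := metric_sym (g w) x; have := metric_sym (g (g x)) x.
have := metric_sym (g (g x)) (g w); rewrite !isom_mdist; have := metric_sym (g x) w.
lra.
Qed.

Lemma disp_mid g x : exists w, d w (g w) <= 0 \/
  d w (g w) <= d x (g (g x)) - d x (g x).
Proof.
have v0 := mdist_ge0 x (g x).
have [||w _ h] := @disp_shrink g x (d x (g x) / 2); [lra|lra|].
by exists w; lra.
Qed.

(** The midpoint of the segment from [v] to [g v] is already a minimum by [disp_mid] and
    [transl_len_ge], so no limit, hence no completeness, is involved. *)
Lemma transl_len_attained g : exists x, d x (g x) = transl_len g.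
Proof.
have [v _] := vertices_neq0 X.
have [w h] := disp_mid g v; exists w.
apply/eqP; rewrite eq_le transl_len_le andbT.
by have := transl_len_ge0 g; have := transl_len_ge g v; lra.
Qed.

Lemma transl_len_iter g x n : n%:R * transl_len g <= d x (iter n g x).
Proof.
have [l0|l0] := lerP (transl_len g) 0.
  by apply: le_trans (mdist_ge0 _ _); rewrite mulr_ge0_le0.
case: n => [|n]; first by rewrite mul0r mdist_ge0.
have [w h] := disp_mid g x; have wl := transl_len_le g w.
have u : d x (g (g x)) - d x (g x) = transl_len g.
  by apply/eqP; rewrite eq_le transl_len_ge; lra.
have := @mdist_iter_ge g x n; rewrite -subr_gt0 u => /(_ l0).
rewrite -natr1 mulrDl mul1r; have := transl_len_le g x; lra.
Qed.

Lemma ball_ball_meet p q s t : 0 <= s -> 0 <= t -> d p q <= s + t ->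
  exists z, d p z <= s /\ d q z <= t.
Proof.
move=> s0 t0 le.
have [ps|sp] := lerP (d p q) s; first by exists q; rewrite mdistxx.
have [||z [_ e1 e2]] := @btw_ex p q s; [lra|lra|].
by exists z; rewrite (metric_sym q); lra.
Qed.

Lemma ball_disp_meet g p s c : 0 <= s -> transl_len g <= c ->
  d p (g p) <= c + 2 * s -> exists z, d p z <= s /\ d z (g z) <= c.
Proof.
move=> s0 lc le.
have [pc|cp] := lerP (d p (g p)) c; first by exists p; rewrite mdistxx.
have l0 := transl_len_ge0 g; have u := transl_len_ge g p.
have [||w pw h] := @disp_shrink g p ((d p (g p) - c) / 2); [lra|lra|].
by exists w; lra.
Qed.

(** The hypothesis puts [x] on the segment from [g^-1 x] to [g x]. Then [g (g x)] is twice as far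
    from [x] as [g x], and the lower bound of [transl_len_ge] is the displacement of [x] itself. *)
Lemma transl_len_same g x : ~ same x (g x) (g^-1%g x) -> transl_len g = d x (g x).
Proof.
move=> /btw_same; rewrite /btw (metric_sym _ x) [d x (g^-1%g x)]metric_sym.
rewrite (metric_sym _ (g^-1%g x)) !isom_mdistV => e.
by have := transl_len_le g x; have := transl_len_ge g x; lra.
Qed.

(* Beyond the set where [g] moves points by at most [c], the segments from [z]
   to [g z] and to [g^-1 z] start towards that set. *)
Lemma same_disp g x z c : d x (g x) <= c -> c < d z (g z) ->
  same z (g z) x /\ same z (g^-1%g z) x.
Proof.
rewrite /same => h1 h2.
have t1 := metric_triangle (g z) (g x) x; have t2 := metric_triangle z x (g x).
have s1 := metric_sym (g x) x; have s2 := metric_sym z (g^-1%g z).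
rewrite isom_mdist in t1; rewrite !isom_mdistV in s2 *.
by split; lra.
Qed.

(** Ping-pong at [z]: [a] and its inverse move [z] in the direction of [x], [b] and its inverse in
    that of [y], and these directions differ. So the path [z], [a z], [a b z] does not fold, and
    [a b z] and its counterpart under the inverse leave [z] on different sides, which puts [z] on
    the axis of [a * b]. *)
Lemma same_disp_mul a b x y z c c' : btw x z y ->
  d x (a x) <= c -> c < d z (a z) -> d y (b y) <= c' -> c' < d z (b z) ->
  transl_len (a * b)%g = d z (a z) + d z (b z).
Proof.
move=> bz ax az by_ bz'.
have [sa sa'] := same_disp ax az; have [sb sb'] := same_disp by_ bz'.
have az0 : 0 < d z (a z) by have := mdist_ge0 x (a x); lra.
have bz0 : 0 < d z (b z) by have := mdist_ge0 y (b y); lra.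
have nxy : ~ same z x y by apply/btw_same.
have N u v : same z u x -> same z v y -> ~ same z u v.
  move=> ux vy uv; apply: nxy; apply: same_trans (same_sym ux) _.
  exact: same_trans uv vy.
have /btw_same e1 := N _ _ sa' sb; have n2 := N _ _ sa sb'.
rewrite /btw !isom_mdistV in e1.
have e3 := esym e1.
rewrite -e3; apply: transl_len_same; rewrite invgM !isom_mulE => h; apply: n2.
apply: (@same_trans _ _ (a (b z))).
  by rewrite /same isom_mdist; lra.
apply: same_trans h _; apply: same_sym.
rewrite /same !isom_mdistV.
rewrite (metric_sym z (b^-1%g _)) !isom_mdistV isomVK.
rewrite (metric_sym z (b^-1%g _)) !isom_mdistV.
rewrite mdist_self_isomV; lra.
Qed.

Lemma disp_lip g x z : d z (g z) - d x (g x) <= 2 * d x z.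
Proof.
have t1 := metric_triangle z x (g z); have t2 := metric_triangle x (g x) (g z).
by rewrite isom_mdist in t2; have := metric_sym x z; lra.
Qed.

Lemma excess_lip (u v k : R) : u - v <= k -> v - u <= k ->
  Num.max u 0 - Num.max v 0 <= k.
Proof. by have [?|?] := lerP u 0; have [?|?] := lerP v 0; lra. Qed.

(* The sets where [a], resp. [b], moves points by at most [c], resp. [c'], are
   convex; if they were disjoint, a point strictly between them would show that
   the axes are far apart, and [transl_len (a * b)] would exceed [c + c']. *)
Lemma disp_disp_meet a b c c' : transl_len a <= c -> transl_len b <= c' ->
  transl_len (a * b)%g <= c + c' ->
  exists z, d z (a z) <= c /\ d z (b z) <= c'.
Proof.
move=> ac bc abc.
have [x ax] := transl_len_attained a; have [y by_] := transl_len_attained b.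
have [phi [D0 phi0 phiD h]] := geodP x y.
(* The excesses are truncated so that at a zero of [P - Q] either both vanish, and the point is as
   wanted, or both are positive, and [same_disp_mul] applies. Each is 2-Lipschitz, whence the 4
   below. *)
pose P t := Num.max (d (phi t) (a (phi t)) - c) 0.
pose Q t := Num.max (d (phi t) (b (phi t)) - c') 0.
have fc : {within `[0, d x y], continuous (fun t => P t - Q t : R^o)}.
  apply: (@lip_within_continuous R _ _ 4) => s t s0 st tD.
  have hst := h s t s0 st tD.
  have L g k : `|Num.max (d (phi s) (g (phi s)) - k) 0 -
                 Num.max (d (phi t) (g (phi t)) - k) 0| <= 2 * (t - s).
    have l1 := disp_lip g (phi s) (phi t); have l2 := disp_lip g (phi t) (phi s).
    have sy := metric_sym (phi s) (phi t).
    rewrite ler_norml lerNl opprB.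
    by apply/andP; split; apply: excess_lip; lra.
  have := L a c; have := L b c'; rewrite /mdist/= -/(P s) -/(P t) -/(Q s) -/(Q t).
  rewrite !ler_norml => /andP[? ?] /andP[? ?]; apply/andP; split; lra.
have P0 : P 0 = 0 by rewrite /P phi0 max_r//; lra.
have QD : Q (d x y) = 0 by rewrite /Q phiD max_r//; lra.
have Qge t : 0 <= Q t by rewrite /Q le_max lexx orbT.
have Pge t : 0 <= P t by rewrite /P le_max lexx orbT.
have [|t] := @IVT R (fun t => P t - Q t) 0 (d x y) 0 D0 fc.
  rewrite P0 QD ge_min le_max; apply/andP; split; apply/orP; [left|right].
    by have := Qge 0; lra.
  by have := Pge (d x y); lra.
rewrite in_itv/= => /andP[t0 tD] PQ.
have bt : btw x (phi t) y by apply: (geod_btw (D := d x y)).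
exists (phi t); move: PQ; rewrite /P /Q.
have [Pt|Pt] := lerP (d (phi t) (a (phi t)) - c) 0;
  have [Qt|Qt] := lerP (d (phi t) (b (phi t)) - c') 0; [lra|lra|lra|].
move=> _; exfalso.
have : transl_len (a * b)%g = d (phi t) (a (phi t)) + d (phi t) (b (phi t)).
  by apply: (@same_disp_mul _ _ x y _ c c' bt); lra.
lra.
Qed.

(** If all three failed, [o] would see [a^-1 o], [a o], [a b o], [(a b)^-1 o], [b^-1 o] and [b o] in
    one direction: each failure links an element to its inverse, and the alignment links [a o] to
    [a b o] and [(a b)^-1 o] to [b^-1 o]. But the alignment, moved by [a^-1], puts [o] between
    [a^-1 o] and [b o]. *)
Lemma transl_len_two_turns o a b : 0 < d o (a o) -> 0 < d o (b o) ->
  btw o (a o) (a (b o)) ->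
  [\/ transl_len a = d o (a o), transl_len b = d o (b o) |
      transl_len (a * b)%g = d o ((a * b)%g o)].
Proof.
move=> a0 b0; rewrite /btw isom_mdist => e.
have [sa|/transl_len_same] := pselect (same o (a o) (a^-1%g o)); last by move=> ?; apply: Or31.
have [sb|/transl_len_same] := pselect (same o (b o) (b^-1%g o)); last by move=> ?; apply: Or32.
have [sab|/transl_len_same] := pselect (same o ((a * b)%g o) ((a * b)^-1%g o));
  last by move=> ?; apply: Or33.
have : same o (a^-1%g o) (b o).
  apply: same_trans (same_sym sa) _.
  apply: (@same_trans _ _ (a (b o))); first by rewrite /same isom_mdist; lra.
  apply: same_trans sab _; apply: same_trans (same_sym sb).
  rewrite invgM isom_mulE /same.
  rewrite !isom_mdistV !(metric_sym o (b^-1%g _)) !isom_mdistV isomVK; lra.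
rewrite /same isom_mdistV mdist_self_isomV; lra.
Qed.

End MetricTree.

(** * Edges and edge paths *)

Lemma nth_last_take (T : Type) (x0 u : T) p n : (n <= size p)%N ->
  nth x0 (u :: p) n = last u (take n p).
Proof. by elim: p u n => [|w p IH] u [|n] //= np; exact: IH. Qed.

Section Edges.
Context {R : realType} {X : realSimplicialTree R}.
Implicit Types (x y z w u v a b : X) (e : set X) (p : seq X).
Local Notation d := (@mdist R X).
Local Notation V := (vertices X).
Local Notation adj := (Defs.adjacent V (edges X)).

(** Betweenness replaces the parametrisation of an edge because an isometry transports it
    directly. *)
Definition ends e a b := [/\ V a, V b, a <> b, forall z, e z <-> btw a z b &
  forall v, V v -> e v -> v = a \/ v = b].

Lemma btw_refll x y : btw x x y. Proof. by rewrite /btw mdistxx add0r. Qed.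

Lemma btw_reflr x y : btw x y y. Proof. by rewrite /btw mdistxx addr0. Qed.

Lemma ends_sym e a b : ends e a b -> ends e b a.
Proof.
case=> Va Vb ab eP eV; split=> // [/esym//|z|v Vv /(eV _ Vv)[]]; [|by right|by left].
by split=> [/eP|h]; [exact: btw_sym|apply/eP; exact: btw_sym].
Qed.

Lemma ends_l e a b : ends e a b -> e a.
Proof. by case=> _ _ _ eP _; apply/eP; exact: btw_refll. Qed.

Lemma ends_r e a b : ends e a b -> e b.
Proof. by move=> /ends_sym; exact: ends_l. Qed.

Lemma ends_ex e : edges X e -> exists a b, ends e a b.
Proof.
move=> Ee; have [L [L0 [phi [sp eV]]]] := edge_segment Ee.
have g := segment_param_geod (ltW L0) sp.
have dL := geod_mdist g; have [_ _ _ h] := g; have [phiE _] := sp.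
have H0 : (e `&` V) (phi 0) by rewrite eV; left.
have HL : (e `&` V) (phi L) by rewrite eV; right.
exists (phi 0), (phi L); split.
- by case: H0.
- by case: HL.
- by move=> E; rewrite E mdistxx in dL; lra.
- move=> z; split=> [|bz].
    rewrite -phiE => -[s /=]; rewrite in_itv/= => /andP[s0 sL] <-.
    by rewrite /btw !h; lra.
  rewrite -phiE; exists (d (phi 0) z).
    rewrite /= in_itv/= mdist_ge0/=; rewrite /btw in bz.
    by have := mdist_ge0 z (phi L); lra.
  rewrite /btw in bz; have z0 := mdist_ge0 (phi 0) z; have z1 := mdist_ge0 z (phi L).
  by apply: (@btw_uniq _ _ (phi 0) (phi L)) => //; rewrite h; lra.
- move=> v Vv ev; have : (e `&` V) v by [].
  by rewrite eV => -[]; [left|right].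
Qed.

Lemma adj_ends u v : adj u v -> exists2 e, edges X e & ends e u v.
Proof.
move=> /asboolP[uv Vu Vv [e Ee [eu ev]]]; exists e => //.
have [a [b E]] := ends_ex Ee; have [_ _ _ _ eV] := E.
case: (eV u Vu eu) => eu'; case: (eV v Vv ev) => ev'; subst => //.
exact: ends_sym.
Qed.

Lemma ends_adj e u v : edges X e -> ends e u v -> adj u v.
Proof.
move=> Ee E; have eu := ends_l E; have ev := ends_r E.
by case: E => Vu Vv uv _ _; apply/asboolP; split=> //; exists e.
Qed.

Lemma btw_convex a b z w (p : X) : btw a z b -> btw a w b -> btw z p w -> btw a p b.
Proof.
wlog le : z w / d a z <= d a w.
  move=> W bz bw bp; have [/W|/ltW/W] := lerP (d a z) (d a w); first exact.
  by apply=> //; exact: btw_sym.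
move=> bz bw; have := btw_mdist bz bw le; rewrite /btw in bz bw * => e1 bp.
have := metric_triangle a z p; have := metric_triangle p w b.
have := metric_triangle a p b; lra.
Qed.

Lemma ends_convex e a b z w (p : X) : ends e a b -> e z -> e w -> btw z p w -> e p.
Proof.
by move=> [_ _ _ eP _] /eP bz /eP bw bp; apply/eP; exact: btw_convex bz bw bp.
Qed.

(** The segments from [x] to [b] and from [b] to [y] stay in [e] and [e'] respectively, which share
    at most one point, so [geod_cat] applies. *)
Lemma edges_btw e e' b x y : edges X e -> edges X e' -> e <> e' ->
  e b -> e' b -> e x -> e' y -> btw x b y.
Proof.
move=> Ee Ee' ne eb e'b ex e'y.
have [a1 [a2 E]] := ends_ex Ee; have [b1 [b2 E']] := ends_ex Ee'.
have [v Vv meet] := edge_meet Ee Ee' ne.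
have [phi g] := geodP x b; have [psi g'] := geodP b y.
rewrite /btw; apply/esym; apply: (geod_cat g g') => s t /andP[s0 sD] /andP[t0 tD] eq.
have [_ phi0 phiD h] := g; have [_ psi0 psiD h'] := g'.
have : e (phi s).
  by apply: (ends_convex E ex eb); exact: geod_btw g s0 sD.
have : e' (psi t).
  by apply: (ends_convex E' e'b e'y); exact: geod_btw g' t0 tD.
rewrite -eq => e'p ep.
have bv : b = v by apply: meet.
have pv : phi s = v by apply: meet.
have : d (psi 0) (psi t) = t - 0 by apply: h'; lra.
by rewrite -eq pv psi0 -bv mdistxx; lra.
Qed.

Lemma edges_eq e e' a b : edges X e -> edges X e' -> e a -> e' a -> e b -> e' b ->
  a <> b -> e = e'.
Proof.
move=> Ee Ee' ea e'a eb e'b ab; apply: contrapT => ne.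
have [v _ meet] := edge_meet Ee Ee' ne.
by apply: ab; rewrite (meet a)// (meet b).
Qed.

Fixpoint vgeo u p : Prop :=
  if p is w :: p' then [/\ adj u w, btw u w (last w p') & vgeo w p'] else True.

(** [v] stands for the vertex visited just before [u], and the path never returns at once to where
    it came from. In a tree this local condition already makes it geodesic. *)
Fixpoint nbpath v u p : Prop :=
  if p is w :: p' then [/\ adj u w, w <> v & nbpath u w p'] else True.

Lemma nbpath_btw e v u p x : edges X e -> ends e v u -> e x -> nbpath v u p ->
  btw x u (last u p).
Proof.
elim: p e v u x => [|w p IH] e v u x Ee E ex; first by move=> _; exact: btw_reflr.
move=> /= [uw wv nb].
have [e' Ee' E'] := adj_ends uw.
have bl := IH _ _ _ _ Ee' E' (ends_l E') nb.
have ne : e <> e'.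
  move=> ee'; have := ends_r E'; rewrite -ee'; have [_ _ _ _ eV] := E.
  have [_ Vw /nesym ww _ _] := E'.
  by case/(eV _ Vw).
have bx := edges_btw Ee Ee' ne (ends_r E) (ends_l E') ex (ends_r E').
have [_ _ uw' _ _] := E'.
by case: (btw_chain bx bl).
Qed.

Lemma nbpath_vgeo v u p : nbpath v u p -> vgeo u p.
Proof.
elim: p v u => //= w p IH v u [uw wv nb]; split=> //; last exact: IH nb.
by have [e Ee E] := adj_ends uw; exact: nbpath_btw Ee E (ends_l E) nb.
Qed.

Lemma uniq_nbpath v u p : path adj u p -> uniq (u :: p) -> v \notin p ->
  nbpath v u p.
Proof.
elim: p v u => //= w p IH v u /andP[uw pp] /andP[uwp /andP[wp up]] vp.
rewrite inE negb_or in vp; case/andP: vp => /eqP vw vp.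
rewrite inE negb_or in uwp; case/andP: uwp => _ uwp.
by split=> //; [exact: nesym|apply: IH; rewrite //= wp].
Qed.

Lemma vertex_path u v : V u -> V v ->
  exists p, [/\ path adj u p, uniq (u :: p) & last u p = v].
Proof.
move=> Vu Vv; have [p pp lp] := tree_connected Vu Vv.
have : last u p = last u p by [].
by case/shortenP: pp lp => p' pp' up' _ <- _; exists p'.
Qed.

Lemma vgeo_ex u v : V u -> V v -> exists2 p, vgeo u p & last u p = v.
Proof.
move=> Vu Vv; have [[|w p] [pp up <-]] := vertex_path Vu Vv; first by exists [::].
exists (w :: p) => //.
move: pp up => /= /andP[uw pp] /andP[uwp up].
have nb : nbpath u w p.
  by apply: uniq_nbpath => //; move: uwp; rewrite inE negb_or => /andP[].
split=> //; last exact: nbpath_vgeo nb.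
by have [e Ee E] := adj_ends uw; exact: nbpath_btw Ee E (ends_l E) nb.
Qed.

(** A simple edge path from [a] to [v] either crosses [e] first, and what follows leaves [e] through
    [b], or it leaves [e] at [a]. *)
Lemma gate_vertex e a b x v : edges X e -> ends e a b -> e x -> V v ->
  btw x a v \/ btw x b v.
Proof.
move=> Ee E ex Vv; have [Va _ _ _ _] := E.
have [p [pp up <-]] := vertex_path Va Vv.
case: p pp up => [|w p] pp up; first by left; exact: btw_reflr.
have [wb|wb] := eqVneq w b.
  right; rewrite /= wb; apply: nbpath_btw Ee E ex _.
  move: pp up; rewrite wb /= => /andP[_ pp] /andP[uwp up].
  by apply: uniq_nbpath => //; move: uwp; rewrite inE negb_or => /andP[].
left; apply: (nbpath_btw Ee (ends_sym E) ex).
move: pp up => /= /andP[uw pp] /andP[uwp up]; split=> //; first exact/eqP.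
by apply: uniq_nbpath => //; move: uwp; rewrite inE negb_or => /andP[].
Qed.

Lemma gate_aux a b b' x y : btw x a b -> btw x a b' -> btw b y b' -> btw x a y.
Proof.
move=> xb xb' by_; apply/btw_same => sxy.
have N v : btw x a v -> btw y a v.
  move=> /btw_same xv; apply/btw_same => yv; apply: xv; exact: same_trans sxy yv.
have yb := N _ xb; have yb' := N _ xb'.
rewrite /btw in yb yb' by_; rewrite /same in sxy.
have := metric_triangle b a b'; have := metric_sym b a; have := metric_sym a y.
have := metric_sym y b; have := metric_triangle x y a; have := metric_sym a x.
have := mdist_ge0 a y; have := metric_triangle a y x; have := metric_sym x y; lra.
Qed.

Lemma gate e a b x y : edges X e -> ends e a b -> e x -> ~ e y ->
  btw x a y \/ btw x b y.
Proof.
move=> Ee E ex ey.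
have [Vy|[e' Ee' e'y]] := vertex_or_edge y; first exact: gate_vertex Ee E ex Vy.
have [c [c' E']] := ends_ex Ee'.
have [Vc Vc' _ e'P _] := E'; have [Va Vb ab eP _] := E.
have bcy : btw c y c' by apply/e'P.
(* If the two ends of [e'] are reached from [x] through different ends of [e], and [x] is neither of
   these, both ends of [e] lie on [e'], so that [e = e']. *)
have C0 (a' b' : X) : ends e a' b' -> btw x a' c -> btw x b' c' ->
    btw x a' y \/ btw x b' y.
  move=> {}E xac xbc.
  have [->|xa] := pselect (x = a'); first by left; exact: btw_refll.
  have [->|xb] := pselect (x = b'); first by right; exact: btw_refll.
  have {}eP : btw a' x b' by case: E => _ _ _ /(_ x)[+ _] _; apply.
  have [|b1 b2] := btw_chain (btw_sym xac) eP; first exact: nesym.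
  have [b3 b4] := btw_chain b2 xbc xb.
  have b5 : btw c a' c'.
    rewrite /btw in b3 xac *; have := metric_triangle a' x c'.
    have := metric_triangle c a' c'.
    have := metric_sym c x; have := metric_sym c a'; have := metric_sym a' x; lra.
  exfalso; apply: ey.
  have -> // : e = e'.
  by apply: (@edges_eq e e' a' b') => //;
    [exact: ends_l E|apply/e'P|exact: ends_r E|apply/e'P|case: E].
have [xac|xbc] := gate_vertex Ee E ex Vc; have [xac'|xbc'] := gate_vertex Ee E ex Vc'.
- by left; exact: gate_aux xac xac' bcy.
- exact: C0.
- by apply/or_comm; apply: C0 => //; exact: ends_sym.
- by right; exact: gate_aux xbc xbc' bcy.
Qed.

Lemma edge_incident x : valence_ge2 X -> exists2 e, edges X e & e x.
Proof.
move=> val; have [/val[e [e' [Ee _ _ ex _]]]|//] := vertex_or_edge x.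
by exists e.
Qed.

Lemma edges_lipschitz (X' : realSimplicialTree R) (f : X -> X') (L : R) :
  valence_ge2 X -> 0 <= L ->
  (forall e x y, edges X e -> e x -> e y -> mdist (f x) (f y) <= L * d x y) ->
  forall x y, mdist (f x) (f y) <= L * d x y.
Proof.
move=> val L0 fe.
have chain x a y : btw x a y -> mdist (f x) (f a) <= L * d x a ->
    mdist (f a) (f y) <= L * d a y -> mdist (f x) (f y) <= L * d x y.
  move=> <- h1 h2; rewrite mulrDr.
  exact: le_trans (metric_triangle _ (f a) _) (lerD h1 h2).
have fv u v : V u -> V v -> mdist (f u) (f v) <= L * d u v.
  move=> Vu Vv; have [p + <-] := vgeo_ex Vu Vv.
  elim: p {Vu} u => [|w p IH] u /=; first by rewrite !mdistxx mulr0.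
  move=> [uw b g]; apply: chain b _ (IH _ g).
  have [e Ee E] := adj_ends uw.
  exact: fe Ee (ends_l E) (ends_r E).
have fxv x v : V v -> mdist (f x) (f v) <= L * d x v.
  move=> Vv; have [e Ee ex] := edge_incident x val.
  have [a [b E]] := ends_ex Ee; have [Va Vb _ _ _] := E.
  case: (gate_vertex Ee E ex Vv) => bt; apply: chain bt _ _; try exact: fv.
    exact: fe Ee ex (ends_l E).
  exact: fe Ee ex (ends_r E).
move=> x y; have [e Ee ex] := edge_incident x val.
have [ey|ey] := pselect (e y); first exact: fe ex ey.
have [a [b E]] := ends_ex Ee; have [Va Vb _ _ _] := E.
case: (gate Ee E ex ey) => bt; apply: chain bt _ _.
- exact: fe Ee ex (ends_l E).
- by rewrite metric_sym (metric_sym a); exact: fxv.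
- exact: fe Ee ex (ends_r E).
- by rewrite metric_sym (metric_sym b); exact: fxv.
Qed.

Lemma vgeo_cat u p1 p2 : vgeo u (p1 ++ p2) ->
  [/\ vgeo u p1, vgeo (last u p1) p2 & btw u (last u p1) (last u (p1 ++ p2))].
Proof.
elim: p1 u => [|w p1 IH] u /=; first by split=> //; exact: btw_refll.
move=> [uw b /IH[g1 g2 b2]]; rewrite /btw in b b2 *; split=> //; last first.
  have := metric_triangle u w (last w p1).
  have := metric_triangle u (last w p1) (last w (p1 ++ p2)); lra.
split=> //; rewrite /btw.
have := metric_triangle u w (last w p1).
have := metric_triangle u (last w p1) (last w (p1 ++ p2)); lra.
Qed.

Lemma vgeo_nth u p i j : vgeo u p -> (i <= j <= size p)%N ->
  d (nth u (u :: p) i) (nth u (u :: p) j) =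
  d u (nth u (u :: p) j) - d u (nth u (u :: p) i).
Proof.
move=> gp; suff H k : (k <= size p)%N -> forall m, (k <= m <= size p)%N ->
    btw u (nth u (u :: p) k) (nth u (u :: p) m).
  move=> /andP[ij jp]; have := H i (leq_trans ij jp) j; rewrite ij jp /btw => /(_ isT) <-.
  by rewrite addrC addKr.
move=> kp m /andP[km mp].
rewrite !nth_last_take ?(leq_trans km)//.
have gm : vgeo u (take m p) by rewrite -(cat_take_drop m p) in gp; case: (vgeo_cat gp).
have : take m p = take k p ++ drop k (take m p).
  by rewrite -{1}(cat_take_drop k (take m p)) take_takel.
by move=> e; rewrite e in gm *; case: (vgeo_cat gm).
Qed.

Lemma vgeo_nth_lt u p i j : vgeo u p -> (i < j <= size p)%N ->
  nth u (u :: p) i != nth u (u :: p) j.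
Proof.
elim: p u i j => [|w p IH] u i j /=; first by move=> _; lia.
move=> [uw b g] /andP[ij jp]; case: j ij jp => // j ij jp /=.
have [e Ee [Vu Vw uw' _ _]] := adj_ends uw.
case: i ij => [|i] ij /=.
  rewrite -mdist_gt0.
  have : btw u w (nth u (w :: p) j).
    have gj : vgeo u (w :: take j p).
      have : vgeo u ((w :: take j p) ++ drop j p) by rewrite /= cat_take_drop.
      by case/vgeo_cat.
    by case: gj => _ + _; rewrite -(@nth_last_take _ u).
  rewrite /btw => <-; move/eqP: uw'; rewrite -mdist_gt0.
  by have := mdist_ge0 w (nth u (w :: p) j); lra.
rewrite !ltnS in ij jp; have := IH w i j g; rewrite ij jp => /(_ isT).
by rewrite (set_nth_default u)/= ?[X in _ != X](set_nth_default u)//= ltnS ltnW ?(leq_trans ij).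
Qed.

Lemma vgeo_vertex u p i : V u -> vgeo u p -> V (nth u (u :: p) i).
Proof.
elim: p u i => [|w p IH] u [|i] Vu //=; first by move=> _; rewrite nth_nil.
move=> [uw _ g]; have [e Ee [_ Vw _ _ _]] := adj_ends uw.
have [ip|ip] := ltnP i (size (w :: p)); last by rewrite nth_default.
by rewrite (set_nth_default w)//; exact: IH.
Qed.

Lemma vgeo_long u n : valence_ge2 X -> V u -> exists2 p, vgeo u p & size p = n.
Proof.
move=> val Vu.
(* The preceding vertex is quantified so that each extension can avoid it: of two edges at [u], one
   leads elsewhere. *)
suff H v : exists2 p, nbpath v u p & size p = n.
  by have [p nb sp] := H u; exists p => //; exact: nbpath_vgeo nb.
elim: n u Vu v => [|n IH] u Vu v; first by exists [::].
have [w uw wv] : exists2 w, adj u w & w <> v.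
  have [e [e' [Ee Ee' ne eu e'u]]] := val u Vu.
  have far f : edges X f -> f u -> exists2 w, f w & adj u w.
    move=> Ef fu; have [a [b E]] := ends_ex Ef; have [_ _ _ _ fV] := E.
    case: (fV u Vu fu) => ua; subst.
      by exists b; [exact: ends_r E|exact: ends_adj E].
    by exists a; [exact: ends_l E|exact: ends_adj (ends_sym E)].
  have [w ew uw] := far e Ee eu; have [w' e'w' uw'] := far e' Ee' e'u.
  have [wv|] := pselect (w = v); last by exists w.
  exists w' => // w'v; apply: ne.
  have [_ _ [_ _ uw1 _ _]] := adj_ends uw.
  by apply: (edges_eq Ee Ee' eu e'u ew) => //; rewrite wv -w'v.
have [_ _ [_ Vw _ _ _]] := adj_ends uw.
have [p nb sp] := IH w Vw u.
by exists (w :: p); rewrite /= ?sp.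
Qed.

Lemma vgeo_size_ge (m : R) u p :
  (forall e x y, edges X e -> ends e x y -> m <= d x y) ->
  vgeo u p -> (size p)%:R * m <= d u (last u p).
Proof.
move=> em; elim: p u => [|w p IH] u /=; first by rewrite mul0r mdistxx.
move=> [uw b g]; have [e Ee E] := adj_ends uw; have := IH _ g; have := em _ _ _ Ee E.
by rewrite -b -natr1 mulrDl mul1r; lra.
Qed.

Lemma vgeo_size_le (l : R) u p :
  (forall e x y, edges X e -> e x -> e y -> d x y <= l) ->
  vgeo u p -> d u (last u p) <= (size p)%:R * l.
Proof.
move=> em; elim: p u => [|w p IH] u /=; first by rewrite mul0r mdistxx.
move=> [uw b g]; have [e Ee E] := adj_ends uw; have := IH _ g.
have := em _ _ _ Ee (ends_l E) (ends_r E).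
by rewrite -b -natr1 mulrDl mul1r; lra.
Qed.

End Edges.

(** * Free actions with finite quotient *)

Lemma subsingleton_finite T (A : set T) :
  (forall x y, A x -> A y -> x = y) -> finite_set A.
Proof.
move=> h; have [->|/set0P[x Ax]] := eqVneq A set0; first exact: finite_set0.
by apply: sub_finite_set (finite_set1 x) => y Ay /=; exact: h.
Qed.

Lemma finite_reps (T U : choiceType) (A : set T) (q : T -> U) :
  finite_set (q @` A) ->
  exists s : seq T, (forall x, x \in s -> A x) /\
    forall x, A x -> exists2 y, y \in s & q y = q x.
Proof.
have [->|/set0P[t0 At0]] := eqVneq A set0; first by move=> _; exists [::].
move=> /finite_seqP[os osE].
pose r o := xget t0 [set t | A t /\ q t = o].
have rP o : o \in os -> A (r o) /\ q (r o) = o.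
  move=> oos; have : [set` os] o by [].
  rewrite -osE => -[t At qt]; exact: (@xgetI _ t0 [set t | A t /\ q t = o] t).
exists (map r os); split=> [x /mapP[k /rP[? _] ->] // | x Ax].
have xos : q x \in os by have : (q @` A) (q x); [exists x|rewrite osE].
exists (r (q x)); first exact: map_f.
by have [] := rP _ xos.
Qed.

Section Action.
Context {R : realType} {X : realSimplicialTree R} (G : set (isom X)).
Context (val : valence_ge2 X) (hG : group_closed [in G])
  (fq : finite_quotient G)
  (Glen : forall g, G g -> g <> 1%g -> 0 < transl_len g).
Implicit Types (x y z w u v a b : X) (g h : isom X) (e : set X).
Local Notation d := (@mdist R X).
Local Notation V := (vertices X).
Local Notation adj := (Defs.adjacent V (edges X)).

Lemma G1 : G 1%g.
Proof. by case: hG => + _; rewrite inE. Qed.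

Lemma GV g : G g -> G g^-1%g.
Proof. by move=> Gg; have := group_closedV hG; move/(_ g); rewrite !inE; apply. Qed.

Lemma GM g h : G g -> G h -> G (g * h)%g.
Proof.
by move=> Gg Gh; have := group_closedM hG; move/(_ g h); rewrite !inE; apply.
Qed.

Lemma act_free g x : G g -> g x = x -> g = 1%g.
Proof.
move=> Gg gx; apply: contrapT => /(Glen Gg) l0.
by have := transl_len_le g x; rewrite gx mdistxx; lra.
Qed.

Lemma act_inj g h x : G g -> G h -> g x = h x -> g = h.
Proof.
move=> Gg Gh gh; have : (h^-1 * g)%g = 1%g.
  by apply: (@act_free _ x); [exact: GM (GV Gh) Gg|rewrite isom_mulE gh isomKV].
by move/(congr1 (fun k => (h * k)%g)); rewrite mulVKg mulg1.
Qed.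

Lemma isom_vertex g v : V v -> V (g v).
Proof. by case: (isomP g) => _ _ + _; apply. Qed.

Lemma isom_vertexV g v : V (g v) -> V v.
Proof. by move=> /(isom_vertex g^-1%g); rewrite isomKV. Qed.

Lemma isom_edge g e : edges X e -> edges X (g @` e).
Proof. by case: (isomP g) => _ _ _; apply. Qed.

Lemma ends_image g e a b : ends e a b -> ends (g @` e) (g a) (g b).
Proof.
case=> Va Vb ab eP eV; split.
- exact: isom_vertex.
- exact: isom_vertex.
- by move=> /(congr1 g^-1%g); rewrite !isomKV.
- move=> z; rewrite -(isomVK g z); split.
    by move=> [x ex /(congr1 g^-1%g)]; rewrite !isomKV => <-; apply/isom_btw/eP.
  by move=> /(isom_btw g^-1%g); rewrite !isomKV => /eP ez; exists (g^-1%g z).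
- by move=> v + [x ex gx]; rewrite -gx => /isom_vertexV Vx; case: (eV x Vx ex) => ->; [left|right].
Qed.

Lemma isom_adj g u v : adj u v -> adj (g u) (g v).
Proof.
move=> /adj_ends[e Ee E]; exact: ends_adj (isom_edge g Ee) (ends_image g E).
Qed.

Lemma image_isom1 e : (1 : isom X)%g @` e = e.
Proof. by rewrite (_ : isom_fun 1%g = id) ?image_id. Qed.

Lemma edge_reps : exists s : seq (set X), (forall e, e \in s -> edges X e) /\
  forall e, edges X e -> exists2 e0, e0 \in s & exists2 g, G g & e = g @` e0.
Proof.
have [s [sE sP]] := finite_reps fq.2; exists s; split=> // e Ee.
have [e0 e0s q] := sP e Ee; exists e0 => //.
have : [set g @` e | g in G] e by exists 1%g; [exact: G1|exact: image_isom1].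
by rewrite -q => -[g Gg <-]; exists g.
Qed.

Lemma vertex_reps : exists s : seq X, (forall v, v \in s -> V v) /\
  forall v, V v -> exists2 w, w \in s & exists2 g, G g & v = g w.
Proof.
have [s [sE sP]] := finite_reps fq.1; exists s; split=> // v Vv.
have [w ws q] := sP v Vv; exists w => //.
have : [set g v | g in G] v by exists 1%g => //; exact: G1.
by rewrite -q => -[g Gg <-]; exists g.
Qed.

(** An edge at [v] is a translate of one of finitely many edges. By freeness the translating element
    is determined by the end it sends to [v], so each representative contributes at most two
    neighbours. *)
Lemma finite_nbrs v : finite_set [set u | adj v u].
Proof.
have [s [sE sP]] := edge_reps.
have sub : [set u | adj v u] `<=` \bigcup_(e in [set` s])
    [set u | exists g a b, [/\ G g, ends e a b, g a = v & u = g b]].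
  move=> u /= /adj_ends[e /sP[e0 e0s [g Gg eE]] E]; exists e0 => //.
  exists g, (g^-1%g v), (g^-1%g u); rewrite !isomVK; split=> //.
  have -> : e0 = g^-1%g @` e.
    rewrite eE image_comp (_ : g^-1%g \o g = id) ?image_id//.
    by apply/funext => x /=; rewrite isomKV.
  exact: ends_image.
apply: sub_finite_set sub _; apply: bigcup_finite => [|e es]; first exact: finite_seq.
have [a [b E]] := ends_ex (sE e es).
have sub2 : [set u | exists g a b, [/\ G g, ends e a b, g a = v & u = g b]] `<=`
   [set u | exists2 g, G g & g a = v /\ u = g b] `|`
   [set u | exists2 g, G g & g b = v /\ u = g a].
  move=> u [g [a' [b' [Gg E' ga gb]]]].
  have [Va' Vb' ab' _ _] := E'; have [_ _ _ _ eV] := E.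
  case: (eV a' Va' (ends_l E')) => ea; case: (eV b' Vb' (ends_r E')) => eb; subst => //.
    by left; exists g.
  by right; exists g.
apply: sub_finite_set sub2 _; rewrite finite_setU; split;
  apply: subsingleton_finite => x y [g Gg [gv ->]] [h Gh [hv ->]];
  by rewrite (act_inj Gg Gh (etrans gv (esym hv))).
Qed.

(** Monotonicity lets a maximum over edge representatives serve; invariance spreads it over the
    orbits. *)
Lemma edge_bound (P : set X -> R -> Prop) :
  (forall e, edges X e -> exists r, P e r) ->
  (forall e r r', P e r -> r <= r' -> P e r') ->
  (forall g e r, G g -> edges X e -> P e r -> P (g @` e) r) ->
  exists r, forall e, edges X e -> P e r.
Proof.
move=> Pex Pmono PG; have [s [sE sP]] := edge_reps.
suff [r rP] : exists r, forall e, e \in s -> P e r.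
  by exists r => e /sP[e0 e0s [g Gg ->]]; apply: PG => //; [exact: sE|exact: rP].
elim: s sE {sP} => [|e s IH] sE; first by exists 0.
have [|r rP] := IH; first by move=> e' e's; apply: sE; rewrite inE e's orbT.
have [r' r'P] := Pex e (sE _ (mem_head _ _)).
exists (Num.max r r') => e'; rewrite inE => /orP[/eqP ->|/rP].
  by apply: Pmono r'P _; rewrite le_max lexx orbT.
by move=> h; apply: Pmono h _; rewrite le_max lexx.
Qed.

Lemma edge_length_ub : exists2 l, 0 <= l &
  forall e x y, edges X e -> e x -> e y -> d x y <= l.
Proof.
have [||g e r Gg Ee h _ _ [x ex <-] [y ey <-]|l lP] :=
  @edge_bound (fun e r => forall x y, e x -> e y -> d x y <= r).
- move=> e Ee; have [a [b E]] := ends_ex Ee; exists (d a b + d a b) => x y ex ey.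
  have [_ _ _ eP _] := E; move/eP: ex; move/eP: ey; rewrite /btw.
  have := metric_triangle x a y; have := metric_sym x a.
  have := mdist_ge0 x b; have := mdist_ge0 y b; lra.
- by move=> e r r' h rr' x y ex ey; apply: le_trans (h x y ex ey) rr'.
- by rewrite isom_mdist; exact: h.
have [v Vv] := vertices_neq0 X; have [e Ee ev] := edge_incident v val.
exists l => [|e' x y Ee']; last exact: lP.
by have := lP e Ee v v ev ev; rewrite mdistxx.
Qed.

Lemma edge_length_lb : exists2 m, 0 < m &
  forall e x y, edges X e -> ends e x y -> m <= d x y.
Proof.
have [||g e r Gg Ee [r0 h]|l lP] :=
  (* Here [r] bounds the inverse of the length, which turns a lower bound into a property stable
     under increasing [r]. *)
  @edge_bound (fun e r => 0 < r /\ forall x y, e x -> e y -> V x -> V y ->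
    x <> y -> r^-1 <= d x y).
- move=> e Ee; have [a [b E]] := ends_ex Ee; exists (d a b)^-1.
  have [_ _ ab _ eV] := E; have d0 : 0 < d a b by rewrite mdist_gt0; apply/eqP.
  rewrite invr_gt0; split=> // x y ex ey Vx Vy xy; rewrite invrK.
  by case: (eV x Vx ex) => ?; case: (eV y Vy ey) => ?; subst => //; rewrite metric_sym.
- move=> e r r' [r0 h] rr'; split; first exact: lt_le_trans rr'.
  move=> x y ex ey Vx Vy xy; apply: le_trans (h x y ex ey Vx Vy xy).
  by rewrite lef_pV2 ?posrE//; exact: lt_le_trans rr'.
- split=> // _ _ [x ex <-] [y ey <-] /isom_vertexV Vx /isom_vertexV Vy xy.
  by rewrite isom_mdist; apply: h => // e'; apply: xy; rewrite e'.
have [v Vv] := vertices_neq0 X; have [e Ee ev] := edge_incident v val.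
have [l0 _] := lP e Ee.
exists l^-1; rewrite ?invr_gt0// => e' x y Ee' E; have [_ h] := lP e' Ee'.
by have := E => -[Vx Vy xy _ _]; apply: h => //; [exact: ends_l E|exact: ends_r E].
Qed.

(** Edges have length at least [m], so the ball is contained in a combinatorial one, finite by
    [finite_nbrs]. *)
Lemma finite_ball v r : V v -> finite_set [set u | V u /\ d v u <= r].
Proof.
move=> Vv; have [m m0 mP] := edge_length_lb.
have B n : finite_set [set u | exists p, [/\ vgeo v p, (size p <= n)%N & last v p = u]].
  elim: n v {Vv} => [|n IH] v.
    apply: sub_finite_set (finite_set1 v) => u [[|w p] [_ //]] _ <-.
  apply: (@sub_finite_set _ _ ([set v] `|` \bigcup_(w in [set w | adj v w])
     [set u | exists p, [/\ vgeo w p, (size p <= n)%N & last w p = u]])).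
    move=> u [[|w p] [/= gp sp <-]]; first by left.
    by case: gp => vw _ g; right; exists w => //; exists p.
  rewrite finite_setU; split; first exact: finite_set1.
  by apply: bigcup_finite => [|w _]; [exact: finite_nbrs|exact: IH].
pose n := Num.bound (`|r| / m).
apply: sub_finite_set (B n) => u [Vu vu].
have [p gp lp] := vgeo_ex Vv Vu; exists p; split=> //.
have := vgeo_size_ge mP gp; rewrite lp -ler_pdivlMr// => sp.
rewrite -(ler_nat R); apply: le_trans sp _; apply: le_trans (ltW (archi_boundP _)).
  by rewrite ler_pM2r ?invr_gt0// (le_trans vu)// ler_norm.
by rewrite divr_ge0// ltW.
Qed.

Lemma finite_moves x y r : finite_set [set g | G g /\ d x (g y) <= r].
Proof.
have [v Vv] := vertices_neq0 X.
apply: (@sub_finite_set _ _ (\bigcup_(u in [set u | V u /\ d v u <= d v x + r + d y v])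
   [set g | G g /\ g v = u])).
  move=> g [Gg xy]; exists (g v) => //; split; first exact: isom_vertex.
  have := metric_triangle v x (g v); have := metric_triangle x (g y) (g v).
  by rewrite isom_mdist; lra.
apply: bigcup_finite => [|u _]; first exact: finite_ball.
apply: subsingleton_finite => g h [Gg gu] [Gh hu].
exact: act_inj Gg Gh (etrans gu (esym hu)).
Qed.

(** * Equivariant piecewise affine maps *)

Section Morphism.
Context {X' : realSimplicialTree R} (rho : isom X -> isom X').
Context (rhoM : forall g h, G g -> G h -> rho (g * h)%g = (rho g * rho h)%g).
Implicit Types (f fV : X -> X').
Local Notation d' := (@mdist R X').

Lemma rho1 : rho 1%g = 1%g.
Proof. by apply: (mulgI (rho 1%g)); rewrite -rhoM ?mulg1//; exact: G1. Qed.

Lemma rhoV g : G g -> rho g^-1%g = (rho g)^-1%g.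
Proof.
move=> Gg; apply: (mulgI (rho g)); rewrite -rhoM ?mulgV ?rho1//; exact: GV.
Qed.

(* The image under the extension of [fV] of a point [x] of an edge [[a, b]]. *)
Definition affine_at (fV : X -> X') x (z : X') := forall e a b,
  edges X e -> ends e a b -> e x -> d' (fV a) z * d a b = d' (fV a) (fV b) * d a x.

Lemma affine_at_btw fV x (z : X') e a b : edges X e -> ends e a b -> e x ->
  affine_at fV x z -> btw (fV a) z (fV b).
Proof.
move=> Ee E ex h; have h1 := h _ _ _ Ee E ex; have h2 := h _ _ _ Ee (ends_sym E) ex.
have [_ _ /eqP + eP _] := E; rewrite -mdist_gt0 => ab.
move/eP: ex => bx; rewrite /btw in bx *; apply: (mulIf (lt0r_neq0 ab)).
have h3 : d' z (fV b) * d a b = d' (fV a) (fV b) * d x b.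
  by rewrite metric_sym [d a b]metric_sym h2 metric_sym (metric_sym b x).
by rewrite mulrDl h1 h3 -mulrDr bx.
Qed.

Lemma affine_at_uniq fV x (z z' : X') : affine_at fV x z -> affine_at fV x z' -> z' = z.
Proof.
move=> h h'; have [e Ee ex] := edge_incident x val; have [a [b E]] := ends_ex Ee.
have [_ _ /eqP + eP _] := E; rewrite -mdist_gt0 => /lt0r_neq0 ab.
have ba : d b a != 0 by rewrite metric_sym.
apply: (btw_uniq (affine_at_btw Ee E ex h)).
  by apply: (mulIf ab); rewrite (h _ _ _ Ee E ex) (h' _ _ _ Ee E ex).
rewrite metric_sym [RHS]metric_sym; apply: (mulIf ba).
by rewrite (h _ _ _ Ee (ends_sym E) ex) (h' _ _ _ Ee (ends_sym E) ex).
Qed.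

Lemma affine_at_vertex fV v : V v -> affine_at fV v (fV v).
Proof.
move=> Vv e a b Ee [_ _ _ _ eV] ev.
by case: (eV v Vv ev) => ->; rewrite ?mdistxx ?mul0r ?mulr0.
Qed.

Lemma affine_at_ex fV x : exists z : X', affine_at fV x z.
Proof.
have [Vx|nVx] := pselect (V x); first by exists (fV x); exact: affine_at_vertex.
have [e Ee ex] := edge_incident x val; have [a [b E]] := ends_ex Ee.
have [_ _ /eqP + eP _] := E; rewrite -mdist_gt0 => ab.
have abN := lt0r_neq0 ab.
have bx : btw a x b by apply/eP.
have xa0 := mdist_ge0 a x; have xb0 := mdist_ge0 x b; rewrite /btw in bx.
have [||z [bz az zb]] :=
  @btw_ex _ _ (fV a) (fV b) (d' (fV a) (fV b) * (d a x / d a b)).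
- by rewrite mulr_ge0 ?mdist_ge0// divr_ge0// ltW.
- by rewrite ler_piMr ?mdist_ge0// ler_pdivrMr// mul1r; lra.
have h1 : d' (fV a) z * d a b = d' (fV a) (fV b) * d a x.
  by rewrite az -mulrA divfK.
have h2 : d' (fV b) z * d b a = d' (fV b) (fV a) * d b x.
  rewrite (metric_sym _ z) zb (metric_sym b a) (metric_sym _ (fV a)) (metric_sym b x).
  by rewrite mulrBl -mulrA divfK// -mulrBr -bx addrC addKr.
exists z => e' a' b' Ee' E' e'x.
(* A point that is not a vertex lies on a single edge, so only the two orderings of its ends
   remain. *)
have ee' : e' = e.
  apply: contrapT => ne; have [v Vv meet] := edge_meet Ee' Ee ne.
  by apply: nVx; rewrite (meet x).
have [Va' Vb' ab' _ _] := E'; have [_ _ _ _ eV] := E.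
have ea' := ends_l E'; have eb' := ends_r E'; rewrite ee' in ea' eb'.
by case: (eV a' Va' ea') => ?; case: (eV b' Vb' eb') => ?; subst.
Qed.

Lemma affine_extension fV :
  (forall g v, G g -> V v -> fV (g v) = rho g (fV v)) ->
  exists2 f, affine_maps G rho f & forall v, V v -> f v = fV v.
Proof.
move=> fVG; have /choice[f fP] := affine_at_ex fV; exists f; last first.
  by move=> v Vv; apply: affine_at_uniq (fP v); exact: affine_at_vertex.
split; last first.
  (* Pulling the edge back by [g^-1] shows that [rho g (f x)] solves the equations at [g x], whose
     solution is unique. *)
  move=> g x Gg; apply: (affine_at_uniq _ (fP (g x))) => e a b Ee E ex.
  have [Va Vb _ _ _] := ends_image g^-1%g E.
  have E' := ends_image g^-1%g E.
  have := fP x _ _ _ (isom_edge g^-1%g Ee) E'.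
  have e'x : (g^-1%g @` e) x by exists (g x) => //; rewrite isomKV.
  move/(_ e'x); rewrite isom_mdist -(isom_mdist (rho g)) -fVG// isomVK => ->.
  by rewrite -(isom_mdist (rho g)) -!fVG// !isomVK isom_mdistV.
move=> e Ee; have [a [b E]] := ends_ex Ee.
have [_ _ /eqP + eP _] := E; rewrite -mdist_gt0 => ab.
exists (d' (fV a) (fV b) / d a b); first by rewrite divr_ge0// mdist_ge0.
have F x : e x -> d' (fV a) (f x) = d' (fV a) (fV b) / d a b * d a x.
  move=> ex; apply: (mulIf (lt0r_neq0 ab)); rewrite (fP x _ _ _ Ee E ex).
  by rewrite mulrAC divfK// lt0r_neq0.
have C0 : 0 <= d' (fV a) (fV b) / d a b by rewrite divr_ge0// mdist_ge0.
move=> x y; wlog le : x y / d a x <= d a y.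
  move=> W ex ey; have [/W|/ltW/W] := lerP (d a x) (d a y); first exact.
  by rewrite metric_sym (metric_sym x); apply.
move=> ex ey.
have bx := affine_at_btw Ee E ex (fP x); have by_ := affine_at_btw Ee E ey (fP y).
rewrite (btw_mdist bx by_); last by rewrite !F// ler_wpM2l.
have -> : d x y = d a y - d a x by apply: (@btw_mdist _ _ a b) => //; exact/eP.
by rewrite !F// mulrBr.
Qed.

Lemma affine_maps_lipschitz f (L : R) : affine_maps G rho f -> 0 <= L ->
  (forall e a b, edges X e -> ends e a b -> d' (f a) (f b) <= L * d a b) ->
  forall x y, d' (f x) (f y) <= L * d x y.
Proof.
move=> [faff _] L0 h; apply: edges_lipschitz => // e x y Ee ex ey.
have [C C0 fe] := faff e Ee; have [a [b E]] := ends_ex Ee.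
rewrite fe// ler_wpM2r ?mdist_ge0//.
have [_ _ /eqP + _ _] := E; rewrite -mdist_gt0 => ab.
have := h _ _ _ Ee E; rewrite fe ?ler_pM2r//; [exact: ends_l E|exact: ends_r E].
Qed.

Lemma affine_maps_is_lipschitz f : affine_maps G rho f -> is_lipschitz f.
Proof.
move=> fA; have [faff feq] := fA.
have [||g e r Gg Ee h _ _ [x ex <-] [y ey <-]|L LP] :=
  @edge_bound (fun e r => forall x y, e x -> e y -> d' (f x) (f y) <= r * d x y).
- by move=> e /faff[C _ fe]; exists C => x y ex ey; rewrite fe.
- move=> e r r' h rr' x y ex ey; apply: le_trans (h x y ex ey) _.
  by rewrite ler_wpM2r ?mdist_ge0.
- by rewrite !feq// !isom_mdist; exact: h.
exists (Num.max L 0); split; first by rewrite le_max lexx orbT.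
apply: affine_maps_lipschitz fA _ _ => [|e a b Ee E]; first by rewrite le_max lexx orbT.
apply: le_trans (LP e Ee _ _ (ends_l E) (ends_r E)) _.
by rewrite ler_wpM2r ?mdist_ge0// le_max lexx.
Qed.

Lemma orbit_section : exists (rep : X -> X) (gel : X -> isom X),
  [/\ forall x, G (gel x) /\ gel x (rep x) = x,
      forall g x, G g -> rep (g x) = rep x &
      exists s : seq X, forall v, V v -> rep v \in s].
Proof.
have [v0 _] := vertices_neq0 X; pose orb x := [set g x | g in G].
(* [xget] depends on the orbit as a set only, so all points of an orbit get the same
   representative. *)
pose rep x := xget v0 (orb x).
have orbG g x : G g -> orb (g x) = orb x.
  move=> Gg; apply/seteqP; split=> [_ [h Gh <-]|_ [h Gh <-]].
    by exists (h * g)%g => //; exact: GM.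
  exists (h * g^-1)%g; first exact: GM Gh (GV Gg).
  by rewrite isom_mulE isomKV.
have repG g x : G g -> rep (g x) = rep x by move=> Gg; rewrite /rep orbG.
have /choice[gel gelP] : forall x, exists g, G g /\ g (rep x) = x.
  move=> x; have : orb x (rep x).
    by apply: (@xgetI _ v0 (orb x) x); exists 1%g => //; exact: G1.
  by move=> [g Gg <-]; exists g^-1%g; rewrite isomKV; split=> //; exact: GV.
exists rep, gel; split=> //.
have [s [sV sP]] := vertex_reps; exists (map rep s) => v /sP[w ws [g Gg ->]].
by rewrite repG//; exact: map_f.
Qed.

(** Equivariance on vertices holds for any [Y]: [gel (g v)] and [g * gel v] send the representative
    to the same point, so they agree by freeness. *)
Lemma equivariant_extension (rep : X -> X) (gel : X -> isom X) (Y : X -> X') :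
  (forall x, G (gel x) /\ gel x (rep x) = x) ->
  (forall g x, G g -> rep (g x) = rep x) ->
  exists2 f, affine_maps G rho f & forall v, V v -> f v = rho (gel v) (Y (rep v)).
Proof.
move=> gelP repG; apply: affine_extension => g v Gg Vv.
rewrite repG// -isom_mulE -rhoM//; last by case: (gelP v).
have [Gv ev] := gelP v; have [Ggv egv] := gelP (g v).
rewrite (@act_inj (gel (g v)) (g * gel v)%g (rep v))//; first exact: GM.
by rewrite isom_mulE ev -{1}(repG g)// egv.
Qed.

Lemma affine_maps_neq0 : affine_maps G rho !=set0.
Proof.
have [v' _] := vertices_neq0 X'; have [rep [gel [gelP repG _]]] := orbit_section.
by have [f fA _] := equivariant_extension (fun=> v') gelP repG; exists f.
Qed.

End Morphism.

End Action.

(** * Existence of an optimal map *)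

Section OptimalMap.
Context {R : realType} {X X' : realSimplicialTree R} (G : set (isom X)).
Context (val : valence_ge2 X) (hG : group_closed [in G])
  (fq : finite_quotient G)
  (Glen : forall g, G g -> g <> 1%g -> 0 < transl_len g)
  (rho : isom X -> isom X')
  (rhoM : forall g h, G g -> G h -> rho (g * h)%g = (rho g * rho h)%g).
Implicit Types (x y z w u v a b : X) (g h : isom X) (e : set X).
Local Notation d := (@mdist R X).
Local Notation d' := (@mdist R X').
Local Notation V := (vertices X).
Let GMh := GM hG.
Let GVh := GV hG.

Lemma rho_mdistV g (p q : X') : G g -> d' (rho g^-1%g p) q = d' p (rho g q).
Proof. by move=> Gg; rewrite (rhoV hG rhoM Gg) isom_mdistV. Qed.

Lemma mdist_rho g h (p q : X') : G g -> G h ->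
  d' (rho g p) (rho h q) = d' p (rho (g^-1 * h)%g q).
Proof.
move=> Gg Gh; rewrite (rhoM (GVh Gg) Gh) isom_mulE.
by rewrite [RHS]metric_sym (rho_mdistV _ _ Gg) metric_sym.
Qed.

Lemma mdist_isom_act g h x y : d (g x) (h y) = d x ((g^-1 * h)%g y).
Proof. by rewrite isom_mulE [RHS]metric_sym isom_mdistV metric_sym. Qed.

Section Bound.
Context (L : R) (L0 : 0 <= L)
  (hL : forall g, G g -> transl_len (rho g) <= L * transl_len g).

(* The constraints on the image [y] of a new point [v]: balls around the images
   already chosen ([Some w]) and displacement sets ([None]). *)
Definition constraint (Y : X -> X') v (i : isom X * option X) : set X' :=
  if i.2 is Some w then [set y | d' (rho i.1 (Y w)) y <= L * d v (i.1 w)]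
  else [set y | d' y (rho i.1 y) <= L * d v (i.1 v)].

(** The cutoff [r] makes the family finite, as [helly] requires. *)
Definition constraint_active (s : seq X) v r (i : isom X * option X) :=
  G i.1 /\ if i.2 is Some w then w \in s /\ d v (i.1 w) <= r else d v (i.1 v) <= r.

Lemma constraint_active_finite s v r : finite_set (constraint_active s v r).
Proof.
pose A w := [set g | G g /\ d v (g w) <= r].
have fA w : finite_set (A w) by exact: finite_moves.
apply: (@sub_finite_set _ _ ((fun g => (g, None)) @` A v `|`
    \bigcup_(w in [set` s]) ((fun g => (g, Some w)) @` A w))).
  move=> [g [w|]] [/= Gg h]; last by left; exists g.
  by case: h => ws h; right; exists w => //; exists g.
rewrite finite_setU; split; first exact: finite_image.
by apply: bigcup_finite => [|w _]; [exact: finite_seq|exact: finite_image].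
Qed.

(** Two balls meet by the bound on images already chosen, two displacement sets by [hL] for [g * h].
    A ball around the image of [g w] meets the displacement set of [h] by the known bound between
    [g w] and [h (g w)]. These are up to 3 r apart, through [v] and [h v]; hence the factor 3. *)
Lemma constraint_meet (Y : X -> X') (s : seq X) v r i j :
  (forall w u g, w \in s -> u \in s -> G g -> d w (g u) <= 3 * r ->
     d' (Y w) (rho g (Y u)) <= L * d w (g u)) ->
  constraint_active s v r i -> constraint_active s v r j ->
  constraint Y v i `&` constraint Y v j !=set0.
Proof.
move=> HY.
have disp g : G g -> transl_len (rho g) <= L * d v (g v).
  by move=> Gg; apply: le_trans (hL Gg) _; rewrite ler_wpM2l// transl_len_le.
have mixed g w h : G g -> G h -> w \in s -> d v (g w) <= r -> d v (h v) <= r ->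
    exists y : X', d' (rho g (Y w)) y <= L * d v (g w) /\ d' y (rho h y) <= L * d v (h v).
  move=> Gg Gh ws vw vh; apply: ball_disp_meet.
  - by rewrite mulr_ge0 ?mdist_ge0.
  - exact: disp.
  have Ghg := GMh Gh Gg; have Gghg := GMh (GVh Gg) Ghg.
  have e1 : d' (rho g (Y w)) (rho h (rho g (Y w))) =
      d' (Y w) (rho (g^-1 * (h * g))%g (Y w)).
    by rewrite -mdist_rho// (rhoM Gh Gg).
  have e2 : d w ((g^-1 * (h * g))%g w) = d (g w) (h (g w)).
    by rewrite -mdist_isom_act.
  have t1 := metric_triangle (g w) v (h (g w)).
  have t2 := metric_triangle v (h v) (h (g w)).
  rewrite isom_mdist (metric_sym (g w) v) in t1 t2.
  rewrite e1; apply: le_trans (HY _ _ _ ws ws Gghg _) _; rewrite e2; first lra.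
  rewrite (_ : L * d v (h v) + _ = L * (d v (h v) + 2 * d v (g w))); last by ring.
  by rewrite ler_wpM2l//; lra.
case: i j => [g [w|]] [h [u|]] [/= Gg +] [/= Gh +].
- move=> [ws vw] [us vu]; have Ggh := GMh (GVh Gg) Gh.
  apply: ball_ball_meet; rewrite ?mulr_ge0 ?mdist_ge0//.
  rewrite mdist_rho//.
  have e2 : d w ((g^-1 * h)%g u) = d (g w) (h u) by rewrite -mdist_isom_act.
  have t1 := metric_triangle (g w) v (h u); rewrite (metric_sym (g w) v) in t1.
  have r0 : 0 <= r by apply: le_trans vw; exact: mdist_ge0.
  apply: le_trans (HY _ _ _ ws us Ggh _) _; rewrite e2; first lra.
  by rewrite -mulrDr ler_wpM2l.
- by move=> [ws vw] vh; exact: mixed.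
- by move=> vg [us vu]; have [y [? ?]] := mixed _ _ _ Gh Gg us vu vg; exists y.
- move=> vg vh; apply: disp_disp_meet; [exact: disp|exact: disp|].
  rewrite -rhoM//; apply: le_trans (disp _ (GMh Gg Gh)) _.
  rewrite -mulrDr ler_wpM2l// isom_mulE.
  by have := metric_triangle v (g v) (g (h v)); rewrite isom_mdist.
Qed.

(** The radius varies in the induction: placing a new point at scale [r] uses the earlier ones at
    scale 3 r. *)
Lemma lipschitz_orbits (s : seq X) (r : R) : exists Y : X -> X',
  forall v w g, v \in s -> w \in s -> G g -> d v (g w) <= r ->
    d' (Y v) (rho g (Y w)) <= L * d v (g w).
Proof.
elim: s r => [|v s IH] r.
  by have [v' _] := vertices_neq0 X'; exists (fun=> v').
have [vs|vs] := boolP (v \in s).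
  have [Y HY] := IH r; exists Y => u w g us ws; apply: HY.
    by move: us; rewrite inE => /orP[/eqP ->|].
  by move: ws; rewrite inE => /orP[/eqP ->|].
pose r0 := Num.max r 0.
have [rr0 r00] : r <= r0 /\ 0 <= r0 by rewrite /r0 !le_max !lexx orbT.
have [Y HY] := IH (3 * r0).
have [I IE] : exists I : seq (isom X * option X),
    constraint_active s v r0 = [set` I].
  by apply/finite_seqP; exact: constraint_active_finite.
have act i : i \in I -> constraint_active s v r0 i by rewrite IE.
have [||y yP] := @helly _ X' _ I (constraint Y v).
- move=> [g [w|]] _; [exact: convex_ball|exact: convex_disp].
- by move=> i j /act ai /act aj; exact: constraint_meet HY ai aj.
have yP' i : constraint_active s v r0 i -> constraint Y v i y.
  by rewrite IE => iI; exact: yP.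
exists (fun u => if u == v then y else Y u) => u w g us ws Gg uw.
have sN t : t \in v :: s -> t != v -> t \in s by rewrite inE => /orP[->|].
have [uv|uv] := eqVneq u v; have [wv|wv] := eqVneq w v.
- subst; apply: (yP' (g, None)); split=> //=; exact: le_trans uw rr0.
- rewrite metric_sym {1}uv; subst u.
  apply: (yP' (g, Some w)); split=> //=; split; [exact: sN|exact: le_trans uw rr0].
- subst w; have e : d u (g v) = d v (g^-1%g u).
    by rewrite (metric_sym v) isom_mdistV.
  have := yP' (g^-1%g, Some u); rewrite /constraint/= rho_mdistV// -e; apply.
  split; [exact: GVh|split; [exact: sN|rewrite /= -e; exact: le_trans uw rr0]].
- by apply: HY => //; [exact: sN|exact: sN|lra].
Qed.

Lemma lipschitz_map : exists2 f, affine_maps G rho f &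
  forall x y, d' (f x) (f y) <= L * d x y.
Proof.
have [l l0 lP] := edge_length_ub val hG fq.
have [rep [gel [gelP repG [s sP]]]] := orbit_section hG fq.
(* The radius [l] is enough, since only the two ends of an edge are compared. *)
have [Y HY] := lipschitz_orbits s l.
have [f fA fV] := equivariant_extension val hG Glen rhoM Y gelP repG.
exists f => //; apply: (affine_maps_lipschitz val fA L0) => e a b Ee E.
have [Va Vb _ _ _] := E; rewrite !fV//.
have [Ga ea] := gelP a; have [Gb eb] := gelP b.
have e1 : d (rep a) (((gel a)^-1 * gel b)%g (rep b)) = d a b.
  by rewrite -mdist_isom_act ea eb.
rewrite mdist_rho// -e1; apply: HY; [exact: sP|exact: sP|exact: GMh (GVh Ga) Gb|].
by rewrite e1; apply: lP Ee (ends_l E) (ends_r E).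
Qed.

End Bound.

End OptimalMap.

(** * Short loops *)

(** Either the last colour occurs three times, or discarding it costs one colour and at most two
    indices. *)
Lemma exists_three_equal N (c : nat -> nat) (s : seq nat) :
  sorted ltn s -> (N.*2 < size s)%N -> (forall i, i \in s -> c i < N)%N ->
  exists i j k, [/\ [/\ i \in s, j \in s & k \in s], (i < j < k)%N, c i = c j &
    c j = c k].
Proof.
elim: N s => [|N IH] s so sz cN.
  by case: s sz cN {so} => // i s _ /(_ i (mem_head _ _)).
pose t := [seq i <- s | c i == N].
have [t2|t2] := ltnP 2 (size t).
  have tP n : (n < size t)%N -> nth 0 t n \in s /\ c (nth 0 t n) = N.
    by move=> nt; have := mem_nth 0 nt; rewrite mem_filter => /andP[/eqP].
  have st : sorted ltn t by apply: sorted_filter so; exact: ltn_trans.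
  have lt m n : (m < n)%N -> (n < size t)%N -> (nth 0 t m < nth 0 t n)%N.
    move=> mn nt; apply: (sorted_ltn_nth ltn_trans 0 st); rewrite ?inE//.
    exact: ltn_trans nt.
  have [s0 c0] := tP 0 (ltn_trans (ltn_trans (ltn0Sn 0) (ltnSn 1)) t2).
  have [s1 c1] := tP 1 (ltn_trans (ltnSn 1) t2); have [s2 c2] := tP 2 t2.
  exists (nth 0 t 0), (nth 0 t 1), (nth 0 t 2); split=> //; last 2 first.
  - by rewrite c0.
  - by rewrite c1.
  - by rewrite !lt// (ltn_trans _ t2).
have [||i|i [j [k [[si sj sk] ijk cij cjk]]]] := IH [seq i <- s | c i != N].
- by apply: sorted_filter so; exact: ltn_trans.
- have e : (size t + size [seq i <- s | c i != N])%N = size s.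
    by rewrite !size_filter; exact: count_predC.
  by rewrite doubleS in sz; lia.
- by rewrite mem_filter => /andP[ciN /cN]; rewrite ltnS leq_eqVlt (negbTE ciN).
move: si sj sk; rewrite !mem_filter => /andP[_ si] /andP[_ sj] /andP[_ sk].
by exists i, j, k.
Qed.

Lemma archi_le0 (R : realType) (t B : R) :
  (forall n : nat, n%:R * t <= B) -> t <= 0.
Proof.
move=> h; rewrite leNgt; apply/negP => t0.
have B0 : 0 <= B by have := h 0%N; rewrite mul0r.
have := h (Num.bound (B / t)); rewrite leNgt => /negP; apply.
by rewrite -ltr_pdivrMr//; apply: archi_boundP; rewrite divr_ge0// ltW.
Qed.

Lemma finite_gap (R : realType) (A : set R) (C : R) : 0 < C -> finite_set A ->
  (forall x, A x -> x < C) ->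
  exists K, [/\ 0 <= K, K < C & forall x, A x -> x <= K].
Proof.
move=> C0 /finite_seqP[s ->]; elim: s => [|x s IH] h; first by exists 0.
have [|K [K0 KC Ks]] := IH; first by move=> y ys; apply: h; rewrite /= inE ys orbT.
exists (Num.max x K); rewrite le_max K0 orbT gt_max KC h /= ?mem_head//; split=> //.
by move=> y; rewrite inE le_max => /orP[/eqP ->|/Ks ->]; rewrite ?lexx ?orbT.
Qed.

Lemma transl_len_conj_le (R : realType) (X : realSimplicialTree R) (g h : isom X) :
  transl_len (h * g * h^-1)%g <= transl_len g.
Proof.
have [x <-] := transl_len_attained g; apply: le_trans (transl_len_le _ (h x)) _.
by rewrite !isom_mulE isomKV isom_mdist.
Qed.

Lemma transl_len_conj (R : realType) (X : realSimplicialTree R) (g h : isom X) :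
  transl_len (h * g * h^-1)%g = transl_len g.
Proof.
apply/eqP; rewrite eq_le transl_len_conj_le /=.
have := transl_len_conj_le (h * g * h^-1)%g h^-1%g.
by rewrite invgK !mulgA mulVg mul1g -mulgA mulVg mulg1.
Qed.

Section Loops.
Context {R : realType} {X X' : realSimplicialTree R} (G : set (isom X)).
Context (val : valence_ge2 X) (hG : group_closed [in G])
  (fq : finite_quotient G)
  (Glen : forall g, G g -> g <> 1%g -> 0 < transl_len g)
  (rho : isom X -> isom X')
  (rhoM : forall g h, G g -> G h -> rho (g * h)%g = (rho g * rho h)%g).
Context (N : nat) (l : R) (cardN : (vertex_orbits G #= `I_N)%card)
  (lP : forall e x y, edges X e -> e x -> e y -> mdist x y <= l).
Implicit Types (x y z w u v a b : X) (g h : isom X) (e : set X) (p : seq X).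
Implicit Types (f : X -> X').
Local Notation d := (@mdist R X).
Local Notation d' := (@mdist R X').
Local Notation V := (vertices X).
Local Notation adj := (Defs.adjacent V (edges X)).
Let GMh := GM hG.
Let GVh := GV hG.

Lemma length_ub_ge0 : 0 <= l.
Proof.
have [v Vv] := vertices_neq0 X; have [e Ee ev] := edge_incident v val.
by have := lP Ee ev ev; rewrite mdistxx.
Qed.

Lemma orbit_code : exists c : X -> nat, (forall v, V v -> c v < N)%N /\
  forall u v, V u -> V v -> c u = c v -> exists2 g, G g & v = g u.
Proof.
have /card_set_bijP[c [cN cinj _]] := cardN.
pose orb v := [set g v | g in G].
have Ov v : V v -> vertex_orbits G (orb v) by exists v.
exists (fun v => c (orb v)); split=> [v /Ov /cN //|u v /Ov Ou /Ov Ov' cuv].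
have : orb v v by exists 1%g => //; exact: G1.
rewrite -(cinj (orb u) (orb v)) ?inE// => -[g Gg <-]; by exists g.
Qed.

Lemma N_gt0 : (0 < N)%N.
Proof.
have [c [cN _]] := orbit_code; have [v Vv] := vertices_neq0 X.
by apply: leq_ltn_trans (cN v Vv).
Qed.

Lemma vgeo_repeat u p : V u -> vgeo u p -> size p = N.*2 ->
  exists i j k g h, [/\ (i < j < k)%N, (k <= N.*2)%N, G g, G h &
    nth u (u :: p) j = g (nth u (u :: p) i) /\
    nth u (u :: p) k = h (nth u (u :: p) j)].
Proof.
move=> Vu gp sp; have [c [cN cG]] := orbit_code.
have Vn n : V (nth u (u :: p) n) by exact: vgeo_vertex.
have [||i _|i [j [k [[_ _ ks] ijk cij cjk]]]] :=
  @exists_three_equal N (fun n => c (nth u (u :: p) n)) (iota 0 N.*2.+1).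
- exact: iota_ltn_sorted.
- by rewrite size_iota.
- exact: cN.
have [g Gg eg] := cG _ _ (Vn i) (Vn j) cij.
have [h Gh eh] := cG _ _ (Vn j) (Vn k) cjk.
by exists i, j, k, g, h; split=> //; move: ks; rewrite mem_iota ltnS.
Qed.

Lemma path_length u p : path adj u p -> d u (last u p) <= (size p)%:R * l.
Proof.
elim: p u => [|w p IH] u /=; first by rewrite mdistxx mul0r.
move=> /andP[/adj_ends[e Ee E] /IH h].
have := lP Ee (ends_l E) (ends_r E); have := metric_triangle u w (last w p).
by rewrite -natr1 mulrDl mul1r; lra.
Qed.

(* A shortest edge path from [v] to the orbit of [y] has no two vertices in the
   same orbit. *)
Lemma near_orbit v y : V v -> V y -> exists2 g, G g & d v (g y) <= (N.-1)%:R * l.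
Proof.
move=> Vv Vy; have [c [cN cG]] := orbit_code.
pose P n := `[< exists p g, [/\ path adj v p, last v p = g y, G g & size p = n] >].
have exP : exists n, P n.
  have [p pp lp] := tree_connected Vv Vy; exists (size p); apply/asboolP.
  by exists p, 1%g; split=> //; exact: G1.
case: (ex_minnP exP) => n /asboolP[p [g [pp lp Gg sp]]] minn.
exists g => //; rewrite -lp; apply: le_trans (path_length pp) _.
rewrite ler_wpM2r ?length_ub_ge0// ler_nat -ltnS prednK ?N_gt0// sp.
have Vn k q u : V u -> path adj u q -> V (nth u (u :: q) k).
  elim: q u k => [|w q IH] u [|k] Vu //=; first by rewrite nth_nil.
  move=> /andP[/adj_ends[e Ee [_ Vw _ _ _]] pq].
  have [kq|kq] := ltnP k (size (w :: q)); last by rewrite nth_default.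
  by rewrite (set_nth_default w)//; exact: IH.
pose z k := nth v (v :: p) k.
have zinj i j : (i < j)%N -> (j <= n)%N -> c (z i) <> c (z j).
  move=> ij jn cij.
  have [h Gh zj] := cG _ _ (Vn i _ _ Vv pp) (Vn j _ _ Vv pp) cij.
  have mapP q u k : path adj u q -> path adj (isom_fun k u) (map (isom_fun k) q).
    elim: q u => //= w q IH u /andP[uw /IH ->]; rewrite andbT; exact: isom_adj.
  have := minn (i + (n - j))%N; rewrite leqNgt => /(_ _)/negP; apply; last by lia.
  (* The shortcut drops the stretch from [z i] to [z j] and follows the translate by [h^-1] of the
     tail, which ends in the same orbit. *)
  apply/asboolP; exists (take i p ++ map (isom_fun h^-1%g) (drop j p)), (h^-1 * g)%g.
  have zi : h^-1%g (z j) = last v (take i p).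
    by rewrite /z zj isomKV nth_last_take// sp; lia.
  have zj' : z j = last v (take j p) by rewrite /z nth_last_take ?sp.
  split.
  - rewrite cat_path -zi take_path//=; apply: mapP; rewrite zj'.
    by move: pp; rewrite -{1}(cat_take_drop j p) cat_path => /andP[].
  - rewrite last_cat -zi last_map zj' -last_cat cat_take_drop lp; by [].
  - exact: GMh (GVh Gh) Gg.
  - by rewrite size_cat size_map size_takel ?size_drop sp//; lia.
(* The [n + 1] vertices lie in distinct orbits, so [n] is at most [N.-1]. *)
have := @uniq_leq_size _ [seq c (z k) | k <- iota 0 n.+1] (iota 0 N).
rewrite size_map !size_iota; apply.
  rewrite map_inj_in_uniq ?iota_uniq// => i j; rewrite !mem_iota !ltnS /= => ik jk.
  by case: (ltngtP i j) => // ij e; [case: (zinj i j ij jk)|case: (zinj j i ij ik)].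
by move=> _ /mapP[k _ ->]; rewrite mem_iota /=; apply: cN; exact: Vn.
Qed.

Lemma stretch_conj g h : G g -> G h -> stretch rho (h * g * h^-1)%g = stretch rho g.
Proof.
move=> Gg Gh; rewrite /stretch transl_len_conj; congr (_ / _).
rewrite (rhoM (GMh Gh Gg) (GVh Gh)) (rhoM Gh Gg) (rhoV hG rhoM Gh).
exact: transl_len_conj.
Qed.

Lemma short_conj x0 g y : G g -> g <> 1%g -> V y ->
  d y (g y) <= (N.*2)%:R * l ->
  exists2 h, G h & short_elements G x0 N l (h * g * h^-1)%g.
Proof.
move=> Gg gN1 Vy yg; have [e Ee ex0] := edge_incident x0 val.
have [v Vv ev] := edge_endpoint Ee.
have [h Gh vhy] := near_orbit Vv Vy.
exists h => //; split; first exact: GMh (GMh Gh Gg) (GVh Gh).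
  by move/(congr1 (fun k => h^-1 * k * h)%g); rewrite !mulgA mulVg mul1g mulg1 -!mulgA mulVg mulg1 ?mulVg.
rewrite !isom_mulE.
have t1 := metric_triangle x0 (h y) (h (g (h^-1%g x0))).
have t2 := metric_triangle (h y) (h (g y)) (h (g (h^-1%g x0))).
(* From [x0] to the vertex [v] of its edge costs [l], from [v] to [h y] at most N - 1 times [l]:
   together N l, paid on both sides. *)
have t3 := metric_triangle x0 v (h y); have t4 := lP Ee ex0 ev.
rewrite !isom_mdist [d y (h^-1%g x0)]metric_sym isom_mdistV in t2.
rewrite isom_mdist in t1.
have : d x0 (h (g (h^-1%g x0))) <= 2 * (l + (N.-1)%:R * l) + (N.*2)%:R * l by lra.
move/le_trans; apply.
rewrite -{2 3}(prednK N_gt0) -muln2 natrM -natr1.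
have := length_ub_ge0; lra.
Qed.

Lemma vgeo_mdist_le u p i j : vgeo u p -> size p = N.*2 -> (i <= j)%N ->
  (j <= N.*2)%N -> d (nth u (u :: p) i) (nth u (u :: p) j) <= (N.*2)%:R * l.
Proof.
move=> gp sp ij jN; rewrite (vgeo_nth gp); last by rewrite ij sp.
have gj : vgeo u (take j p) by move: gp; rewrite -{1}(cat_take_drop j p) => /vgeo_cat[].
have := vgeo_size_le lP gj; rewrite nth_last_take ?sp// size_takel ?sp//.
have : j%:R * l <= (N.*2)%:R * l by rewrite ler_wpM2r ?length_ub_ge0// ler_nat.
have := mdist_ge0 u (nth u (u :: p) i); lra.
Qed.

Lemma short_elements_neq0 x0 : short_elements G x0 N l !=set0.
Proof.
have [u Vu] := vertices_neq0 X; have [p gp sp] := vgeo_long N.*2 val Vu.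
have [i [j [k [g [h [/andP[ij jk] kN Gg _ [ej _]]]]]]] := vgeo_repeat Vu gp sp.
have jN : (j <= N.*2)%N by exact: leq_trans (ltnW jk) kN.
have [|||t _ Ft] := @short_conj x0 g (nth u (u :: p) i) Gg;
  last by exists (t * g * t^-1)%g.
- move=> g1; have := @vgeo_nth_lt _ _ u p i j gp; rewrite ij sp jN => /(_ isT).
  by rewrite ej g1 eqxx.
- exact: vgeo_vertex.
- by rewrite -ej; apply: vgeo_mdist_le => //; exact: ltnW.
Qed.

Section Map.
Context (f : X -> X') (C : R) (C0 : 0 < C) (feq : equivariant G rho f).
Context (fC : forall x y, d' (f x) (f y) <= C * d x y).

Lemma transl_len_lip g : G g -> transl_len (rho g) <= C * transl_len g.
Proof.
move=> Gg; have [x <-] := transl_len_attained g.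
apply: le_trans (transl_len_le _ (f x)) _.
by rewrite -feq//; exact: fC.
Qed.

(** The chain lambda(rho(g)) <= C lambda(g) <= C d(y, g y) closes up, so every inequality in it is
    an equality. *)
Lemma stretch_eq g y : G g -> g <> 1%g ->
  transl_len (rho g) = d' (f y) (rho g (f y)) ->
  d' (f y) (rho g (f y)) = C * d y (g y) -> stretch rho g = C.
Proof.
move=> Gg g1 tg fg; have tg0 := Glen Gg g1.
rewrite /stretch; apply: (mulIf (lt0r_neq0 tg0)); rewrite divfK ?lt0r_neq0//.
apply/eqP; rewrite eq_le transl_len_lip//= tg fg.
by rewrite ler_wpM2l ?(ltW C0)// transl_len_le.
Qed.

Lemma tight_path x0 u p : V u -> vgeo u p -> size p = N.*2 ->
  C * d u (last u p) <= d' (f u) (f (last u p)) ->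
  exists2 g, short_elements G x0 N l g & stretch rho g = C.
Proof.
move=> Vu gp sp tight.
have [i [j [k [g [h [/andP[ij jk] kN Gg Gh [ej ek]]]]]]] := vgeo_repeat Vu gp sp.
have jN : (j <= N.*2)%N by exact: leq_trans (ltnW jk) kN.
pose z n := nth u (u :: p) n; rewrite -/(z i) -/(z j) -/(z k) in ej ek.
have Vz n : V (z n) by exact: vgeo_vertex.
have dz m n : (m <= n)%N -> (n <= N.*2)%N -> d (z m) (z n) = d u (z n) - d u (z m).
  by move=> mn nN; apply: vgeo_nth => //; rewrite mn sp.
have zne m n : (m < n)%N -> (n <= N.*2)%N -> 0 < d (z m) (z n).
  by move=> mn nN; rewrite mdist_gt0; apply: vgeo_nth_lt => //; rewrite mn sp.
have zl : z N.*2 = last u p by rewrite /z nth_last_take ?sp// -sp take_size.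
(* No part of the path can be stretched by less than [C], since the remaining parts cannot make up
   for it. *)
have fz m n : (m <= n)%N -> (n <= N.*2)%N -> d' (f (z m)) (f (z n)) = C * d (z m) (z n).
  move=> mn nN; apply/eqP; rewrite eq_le fC/=.
  have t1 := metric_triangle (f u) (f (z m)) (f (last u p)).
  have t2 := metric_triangle (f (z m)) (f (z n)) (f (last u p)).
  have l1 := fC u (z m); have l2 := fC (z n) (last u p).
  have := dz n N.*2 nN (leqnn _); have := dz m n mn nN; rewrite zl.
  move=> e1 e2; rewrite e2 mulrBr in l2; rewrite e1 mulrBr; lra.
have ij' := ltnW ij; have jk' := ltnW jk; have ik' := leq_trans ij' jk'.
(* Conjugating [h] by [g] lets both elements be observed from the same point [f (z i)], as
   [transl_len_two_turns] requires; the product with [g] is [h * g], which sends [z i] to [z k]. *)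
have Gb := GMh (GVh Gg) (GMh Gh Gg).
have zk : z k = (g * (g^-1 * (h * g)))%g (z i).
  by rewrite mulVKg isom_mulE -ej.
have bz : d (z i) ((g^-1 * (h * g))%g (z i)) = d (z j) (z k).
  by rewrite -mdist_isom_act isom_mulE -ej -ek.
have fgz t : G t -> d' (f (z i)) (rho t (f (z i))) = d' (f (z i)) (f (t (z i))).
  by move=> Gt; rewrite feq.
have found t : G t -> 0 < d (z i) (t (z i)) -> d (z i) (t (z i)) <= (N.*2)%:R * l ->
    d' (f (z i)) (rho t (f (z i))) = C * d (z i) (t (z i)) ->
    transl_len (rho t) = d' (f (z i)) (rho t (f (z i))) ->
    exists2 g, short_elements G x0 N l g & stretch rho g = C.
  move=> Gt t0 tl ft tt.
  have t1 : t <> 1%g by move=> t1; move: t0; rewrite t1 mdistxx ltxx.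
  have [c Gc Fc] := short_conj x0 Gt t1 (Vz i) tl.
  by exists (c * t * c^-1)%g => //; rewrite stretch_conj//; exact: stretch_eq Gt t1 tt ft.
have fb : d' (f (z i)) (rho (g^-1 * (h * g))%g (f (z i))) = C * d (z j) (z k).
  rewrite -(mdist_rho hG rhoM _ _ Gg (GMh Gh Gg)).
  by rewrite (rhoM Gh Gg) isom_mulE -!feq -?ej -?ek ?fz.
have fg : d' (f (z i)) (rho g (f (z i))) = C * d (z i) (z j).
  by rewrite fgz// -ej fz.
have fgb : rho g (rho (g^-1 * (h * g))%g (f (z i))) = f (z k).
  by rewrite -!feq// zk.
have [||| tt | tt | tt] :=
  @transl_len_two_turns _ _ (f (z i)) (rho g) (rho (g^-1 * (h * g))%g).
- by rewrite fg mulr_gt0// zne.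
- by rewrite fb mulr_gt0// zne.
- by rewrite fgb -feq// -ej /btw !fz// -mulrDr !dz//; congr (_ * _); ring.
- apply: (found g) => //; rewrite -ej//; [exact: zne|exact: vgeo_mdist_le].
- apply: (found _ Gb) => //; rewrite bz//; [exact: zne|exact: vgeo_mdist_le].
- have Ggb := GMh Gg Gb.
  apply: (found _ Ggb); rewrite -?zk; [exact: zne (ltn_trans ij jk) kN|exact: vgeo_mdist_le| |].
  + by rewrite fgz// -zk fz.
  + by rewrite (rhoM Gg Gb).
Qed.

(** The geodesic is cut into blocks of 2N edges, each stretched by at most [K]; the shorter last
    block is covered by the additive term. *)
Lemma coarse_lipschitz (K : R) : 0 <= K ->
  (forall u p, V u -> vgeo u p -> size p = N.*2 ->
     d' (f u) (f (last u p)) <= K * d u (last u p)) ->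
  forall u v, V u -> V v -> d' (f u) (f v) <= K * d u v + C * ((N.*2)%:R * l).
Proof.
move=> K0 H u v Vu Vv; have [p gp <-] := vgeo_ex Vu Vv.
move: {2}(size p) (leqnn (size p)) => n.
elim: n u p Vu gp {v Vv} => [|n IH] u p Vu gp sp.
  move: sp; rewrite leqn0 size_eq0 => /eqP -> /=; rewrite !mdistxx mulr0 add0r.
  by rewrite !mulr_ge0 ?(ltW C0)// length_ub_ge0.
have [pN|pN] := ltnP (size p) N.*2.
  apply: le_trans (fC _ _) _; rewrite ler_wpDl ?mulr_ge0 ?mdist_ge0//.
  rewrite ler_wpM2l ?(ltW C0)//; apply: le_trans (vgeo_size_le lP gp) _.
  by rewrite ler_wpM2r ?length_ub_ge0// ler_nat ltnW.
have := gp; rewrite -{1}(cat_take_drop N.*2 p) => /vgeo_cat[g1 g2].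
rewrite cat_take_drop; set w := last u (take _ p) => bw.
have lw : last w (drop N.*2 p) = last u p by rewrite -last_cat cat_take_drop.
have Vw : V w by rewrite /w -(@nth_last_take _ u)//; exact: vgeo_vertex.
have := IH w (drop N.*2 p) Vw g2; rewrite lw size_drop => h2.
have := H u (take N.*2 p) Vu g1; rewrite size_takel// -/w => /(_ erefl) h1.
have {}h2 : d' (f w) (f (last u p)) <= K * d w (last u p) + C * ((N.*2)%:R * l).
  by apply: h2; have := N_gt0; lia.
have := metric_triangle (f u) (f w) (f (last u p)).
by rewrite /btw in bw; rewrite -bw mulrDr; lra.
Qed.

(** Apply the coarse bound to the n-th iterate of [g]: both translation lengths are multiplied by n,
    while the additive error stays bounded. *)
Lemma transl_len_coarse (K B : R) : 0 <= K ->
  (forall u v, V u -> V v -> d' (f u) (f v) <= K * d u v + B) ->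
  forall g, G g -> transl_len (rho g) <= K * transl_len g.
Proof.
move=> K0 H g Gg; have [x xg] := transl_len_attained g.
have [v Vv] := vertices_neq0 X; rewrite -subr_le0.
apply: (@archi_le0 _ _ (2 * K * d v x + B)) => n.
have fit : f (iter n g v) = iter n (rho g) (f v).
  by elim: n => //= n IH; rewrite feq// IH.
have Vit : V (iter n g v) by elim: n {fit} => //= n; exact: isom_vertex.
have h1 := transl_len_iter (rho g) (f v) n; rewrite -fit in h1.
have h2 := H _ _ Vv Vit.
have t1 := metric_triangle v x (iter n g v).
have t2 := metric_triangle x (iter n g x) (iter n g v).
have h3 := mdist_iter_le g x n.
rewrite mdist_iter (metric_sym x v) in t2; rewrite xg in h3.
have : K * d v (iter n g v) <= K * (2 * d v x + n%:R * transl_len g).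
  by rewrite ler_wpM2l//; lra.
rewrite mulrBr mulrDr [K * (n%:R * _)]mulrCA; lra.
Qed.

(* If no short element is stretched by [C], then no path of [2 N] edges is, and
   by finiteness such paths are stretched by at most some [K < C]. *)
Lemma short_stretch x0 :
  (forall K, (forall g, G g -> transl_len (rho g) <= K * transl_len g) -> C <= K) ->
  exists2 g, short_elements G x0 N l g & stretch rho g = C.
Proof.
move=> Cmin; apply: contrapT => nF.
have [s [sV sP]] := vertex_reps hG fq.
pose ratio w v := d' (f w) (f v) / d w v.
(* Up to the group a path starts at a representative, and its other end then lies in a finite ball,
   so finitely many ratios occur. By [tight_path] none of those coming from paths of 2N edges
   reaches [C]. *)
pose A := \bigcup_(w in [set` s]) (ratio w @` [set v | V v /\ d w v <= (N.*2)%:R * l]).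
have fA : finite_set (A `&` [set x | x < C]).
  apply: (@sub_finite_set _ _ A) => [x []//|].
  apply: bigcup_finite => [|w ws]; first exact: finite_seq.
  by apply: finite_image; apply: (finite_ball val hG fq Glen); exact: sV.
have [|K [K0 KC AK]] := finite_gap C0 fA; first by move=> x [].
have := Cmin K; rewrite leNgt KC => /(_ _)/negP; apply=> //.
apply: (transl_len_coarse K0 (coarse_lipschitz K0 _)) => u p Vu gp sp.
have [w ws [g Gg ug]] := sP u Vu.
set v := last u p; have Vv : V v.
  have := @nth_last_take _ u u p (size p) (leqnn _); rewrite take_size /v => <-.
  exact: vgeo_vertex.
have dwv : d w (g^-1%g v) = d u v by rewrite metric_sym isom_mdistV metric_sym ug.
have fwv : d' (f w) (f (g^-1%g v)) = d' (f u) (f v).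
  rewrite -(isom_mdist (rho g)) -!feq ?isomVK ?ug//.
have uv : 0 < d u v.
  have zl : nth u (u :: p) N.*2 = v by rewrite nth_last_take -?sp// take_size.
  have := @vgeo_nth_lt _ _ u p 0 N.*2 gp; rewrite sp double_gt0 N_gt0 leqnn => /(_ isT).
  by rewrite zl -mdist_gt0.
rewrite -ler_pdivrMr//.
have -> : d' (f u) (f v) / d u v = ratio w (g^-1%g v) by rewrite /ratio dwv fwv.
apply: AK; split.
  exists w => //; exists (g^-1%g v) => //; split; first exact: isom_vertex.
  by rewrite dwv -sp; exact: vgeo_size_le.
rewrite /= /ratio dwv fwv ltr_pdivrMr// ltNge; apply/negP => tight.
by apply: nF; exact: tight_path Vu gp sp tight.
Qed.

End Map.
End Loops.

(** * The optimal Lipschitz constant as the supremum of the stretches *)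

Theorem proposition4p1 (R : realType) (X X' : realSimplicialTree R)
    (hX : valence_ge2 X) (hX' : valence_ge2 X')
    (G : set (isom X)) (hG : group_closed [in G])
    (G_torsion_free : torsion_free G) (G_discrete : discrete_isoms G)
    (G_finite_quotient : finite_quotient G)
    (G_transl_len : forall g, G g -> g <> 1%g -> 0 < transl_len g)
    (rho : isom X -> isom X')
    (rhoM : forall g h, G g -> G h -> rho (g * h)%g = (rho g * rho h)%g) :
  let C := min_lip G rho in
  [/\ affine_maps G rho !=set0 /\
        (forall f, affine_maps G rho f -> is_lipschitz f),
      0 <= C /\ (exists2 f, affine_maps G rho f & lip_const f = C) &
      forall (x0 : X) (N : nat) (l : R),
        (vertex_orbits G #= `I_N)%card ->
        (forall e x y, edges X e -> e x -> e y -> mdist x y <= l) ->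
        let S := [set stretch rho g | g in [set g | G g /\ g <> 1%g]] in
        let F := short_elements G x0 N l in
        [/\ finite_set F,
            has_sup S /\ sup S = C &
            [set stretch rho g | g in F] C /\
              ubound [set stretch rho g | g in F] C]].
Proof.
pose S := [set stretch rho g | g in [set g | G g /\ g <> 1%g]].
pose L := sup S.
have Alip f : affine_maps G rho f -> is_lipschitz f.
  exact: (affine_maps_is_lipschitz hX hG G_finite_quotient).
have Sge0 x : S x -> 0 <= x.
  by move=> [g _ <-]; rewrite divr_ge0// transl_len_ge0.
have Sle f k : affine_maps G rho f -> lip_bounds f k -> ubound S k.
  move=> [_ feq] [k0 fk] _ [g [Gg g1] <-].
  rewrite /stretch ler_pdivrMr; last exact: G_transl_len.
  exact: transl_len_lip feq fk _ Gg.
have [f0 f0A] := affine_maps_neq0 hX hG G_finite_quotient G_transl_len rhoM.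
have [k0 f0k] := Alip f0 f0A.
have Sub : has_ubound S by exists k0; exact: Sle f0k.
have Lub g : G g -> g <> 1%g -> stretch rho g <= L.
  by move=> Gg g1; apply: sup_ubound => //; exists g.
have L0 : 0 <= L.
  (* That some element is nontrivial is only established later, from [short_elements_neq0]; for an
     empty [S] the convention [sup0] gives [L = 0]. *)
  have [S0|/set0P[x Sx]] := eqVneq S set0; first by rewrite /L S0 sup0.
  by apply: le_trans (Sge0 x Sx) _; exact: sup_ubound.
have hL g : G g -> transl_len (rho g) <= L * transl_len g.
  move=> Gg; have [->|g1] := pselect (g = 1%g).
    by rewrite (rho1 hG rhoM) !transl_len1 mulr0.
  by rewrite -ler_pdivrMr ?G_transl_len//; exact: Lub.
have [f fA fL] := lipschitz_map hX hG G_finite_quotient G_transl_len rhoM L0 hL.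
have Lle f' : affine_maps G rho f' -> L <= lip_const f'.
  move=> f'A; apply: lb_le_inf; first exact: Alip.
  move=> k f'k; have kub := Sle _ _ f'A f'k.
  have [S0|SN0] := eqVneq S set0; first by rewrite /L S0 sup0; case: f'k.
  by apply: sup_le_ub => //; exact/set0P.
have fLip : lip_const f = L.
  apply/eqP; rewrite eq_le Lle// andbT; apply: ge_inf; last by split.
  by exists 0 => k [].
have CL : min_lip G rho = L.
  apply/eqP; rewrite eq_le; apply/andP; split.
    rewrite -[X in _ <= X]fLip; apply: ge_inf; last by exists f.
    by exists 0 => _ [f' f'A <-]; apply: le_trans (Lle _ f'A).
  by apply: lb_le_inf => [|_ [f' f'A <-]]; [exists (lip_const f), f|exact: Lle].
rewrite CL; split.
- by split=> //; exists f0.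
- by split=> //; exists f.
move=> x0 N l cardN lP; rewrite -/S.
have FS g : short_elements G x0 N l g -> G g /\ g <> 1%g by case.
have [g0 Fg0] := short_elements_neq0 hX hG cardN lP x0.
have SN0 : S !=set0 by exists (stretch rho g0); exists g0 => //; exact: FS.
split.
- apply: sub_finite_set (finite_moves hX hG G_finite_quotient G_transl_len x0 x0 (4 * N%:R * l)).
  by move=> g [Gg _ h].
- by [].
split; last by move=> _ [g /FS[Gg g1] <-]; exact: Lub.
have [Lpos|Lneg] := ltP 0 L.
  have [_ feq] := fA.
  have [|g Fg sg] := short_stretch hX hG G_finite_quotient G_transl_len rhoM cardN lP
    Lpos feq fL x0 _; last by exists g.
  move=> K HK; apply: sup_le_ub => // _ [g [Gg g1] <-].
  by rewrite /stretch ler_pdivrMr ?G_transl_len//; exact: HK.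
(* Here [L] is 0, so all stretches vanish and any short element attains the maximum. *)
exists g0 => //; have [Gg0 g01] := FS _ Fg0.
by apply/eqP; rewrite eq_le Lub//= (le_trans Lneg)// Sge0//; exists g0.
Qed.
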